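(* Let $X=(X_n)_{n\in\mathbb{Z}_+}$ be a homogeneous Markov chain on $(E,\mathcal{B}(E))$ with $n$-step transition functions $P^n(x,A)$ and Markov operator $P$. Suppose there exist a measurable function $V:E\to[0,\infty)$ and a metric $d$ on $E$ such that the following conditions hold: (1) There exist a concave differentiable function $\varphi:\mathbb{R}_+\to\mathbb{R}_+$ increasing to infinity with $\varphi(0)=0$ and a constant $K\ge 0$ such that $$PV\le V-\varphi\circ V+K .$$ (2) $(E,d)$ is a complete separable metric space. (3) For any $x,y\in E$, $W_d(P(x,\cdot),P(y,\cdot))\le d(x,y)\le 1$. (4) For some $R>\varphi^{-1}(2K)$ there exists $\rho>0$ such that $W_d(P(x,\cdot),P(y,\cdot))\le(1-\rho)\,d(x,y)$ for all $x,y\in E$ with $V(x)+V(y)\le R$. Then $X$ has a unique stationary probability measure $\pi$, and $$\int_E\varphi(V(u))\,\pi(du)\le K.$$ Moreover, for any $\varepsilon>0$ there exist positive constants $C_1$ and $C_2$ such that for all $x\in E$, $$W_d(P^n(x,\cdot),\pi)\le\frac{C_1(1+V(x))}{\varphi\big(H_\varphi^{-1}(C_2 n)\big)^{1-\varepsilon}},\qquad n\in\mathbb{Z}_+ .$$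
   Context: $\mathcal{B}(E)$ is the Borel $\sigma$-algebra of $(E,d)$; $\mathcal{P}(E)$ is the set of probability measures on $(E,\mathcal{B}(E))$. $P^n(x,A)=\mathbb{P}_x(X_n\in A)$, $P=P^1$; $Pf(x)=\int_E f(t)\,P(x,dt)$ for functions and $P\mu(dx)=\int_E P(t,dx)\,\mu(dt)$ for measures. A measure $\pi\in\mathcal{P}(E)$ is stationary if $P\pi=\pi$. Wasserstein (semi)distance: for $\mu,\nu\in\mathcal{P}(E)$, $$W_d(\mu,\nu)=\inf_{\lambda\in\mathcal{C}(\mu,\nu)}\int_{E\times E}d(x,y)\,\lambda(dx,dy),$$ where $\mathcal{C}(\mu,\nu)$ is the set of probability measures on $E\times E$ with marginals $\mu$ and $\nu$. $H_\varphi(x)=\int_1^x\frac{du}{\varphi(u)}$ for $x\ge1$, and $H_\varphi^{-1}$ is its inverse function. *)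

(* Defs.v *)
From HB Require Import structures.
From mathcomp Require Import all_boot all_order all_algebra.
From mathcomp Require Import all_classical all_reals all_analysis.
From mathcomp Require Import measurable_realfun.

Set Implicit Arguments.
Unset Strict Implicit.
Unset Printing Implicit Defensive.

Import Order.TTheory GRing.Theory Num.Theory.
Import numFieldNormedType.Exports.

Local Open Scope classical_set_scope.
Local Open Scope ring_scope.
Local Open Scope ereal_scope.

(* [Complete] makes the carrier pointed, i.e. nonempty. *)
#[short(type="completeMetricType")]
HB.structure Definition CompleteMetric (R : numDomainType) :=
  {T of Complete T & Metric R T}.

Definition separable (T : topologicalType) : Prop :=
  exists2 S : set T, countable S & dense S.

Notation borel E := (g_sigma_algebraType (@open E)).

Definition coupling d (T : measurableType d) (R : realType)
    (mu nu : probability T R) : set (probability (T * T)%type R) :=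
  [set l | forall A, measurable A ->
     l (A `*` setT) = mu A /\ l (setT `*` A) = nu A].

(* Couplings live on the product sigma-algebra, which is the Borel
   sigma-algebra of the product topology as soon as [E] is separable. *)
Definition wasserstein (R : realType) (E : completeMetricType R)
    (mu nu : probability (borel E) R) : \bar R :=
  ereal_inf [set \int[l]_z (mdist (z.1 : E) (z.2 : E))%:E | l in coupling mu nu].

Section MarkovOperator.
Context d (T : measurableType d) (R : realType).
Variable P : T -> probability T R.

Definition markov_fun (f : T -> \bar R) (x : T) : \bar R := \int[P x]_t f t.

Definition markov_measure (mu : probability T R) (A : set T) : \bar R :=
  \int[mu]_t P t A.

(* The values of a [probability] on nonmeasurable sets carry no information. *)
Definition stationary (pi : probability T R) : Prop :=
  forall A, measurable A -> markov_measure pi A = pi A.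

End MarkovOperator.

Section MarkovChain.
Context dO d (Omega : measurableType dO) (T : measurableType d) (R : realType).
Variables (PP : T -> probability Omega R) (X : nat -> {mfun Omega >-> T}).

Definition transition (n : nat) (x : T) : probability T R :=
  distribution (PP x) (X n).

Definition natural_filtration (n : nat) : set (set Omega) :=
  <<s \bigcup_(k in `I_n.+1) preimage_set_system setT (X k) measurable >>.

(* The last clause says that [transition 1 (X n) A] is a version of the
   conditional probability of [X n.+1 \in A] given [natural_filtration n]. *)
Definition homogeneous_markov_chain : Prop :=
  [/\ forall x, PP x (X 0%N @^-1` [set x]) = 1,
      forall A, measurable A ->
        measurable_fun [set: T] (transition 1 ^~ A)
    & forall x n A B, measurable A -> natural_filtration n B ->
        PP x (B `&` X n.+1 @^-1` A) =
        \int[PP x]_(w in B) transition 1 (X n w) A].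

End MarkovChain.

Section Rate.
Context (R : realType).
Variable phi : R -> R.

(* [pinv] is a genuine inverse only on the image. For [phi] concave, continuous
   and increasing from 0 to infinity on [0, +oo[, the images of [phi] on
   [0, +oo[ and of [H_phi phi] on [1, +oo[ are both [0, +oo[, so the inverses
   below are meaningful at every nonnegative argument. *)
Definition phi_inv : R -> R := pinv (`[0%R, +oo[%classic : set R) phi.

Definition H_phi (x : R) : R :=
  (\int[lebesgue_measure]_(u in `[1%R, x]) (phi u)^-1)%R.

Definition H_phi_inv : R -> R := pinv (`[1%R, +oo[%classic : set R) H_phi.

End Rate.

(* Main.v *)
Require Import Defs.
From mathcomp Require Import all_boot all_order all_algebra.
From mathcomp Require Import all_classical all_reals all_analysis.
From mathcomp Require Import measurable_realfun giry.
From mathcomp Require Import ring lra.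

(** Everything is tested on 1-Lipschitz functions: by Kantorovich-Rubinstein
    duality ([kantorovich_rubinstein]) a bound on the Wasserstein distance of two
    laws is a bound on the difference of the means of [f], uniform over
    [lipschitz1 f].  The theorem becomes a statement about the iterates [P^n f]
    of the Markov operator.

    Contraction.  One step contracts the distance where [V x + V y <= R0] and
    lets [V] decrease elsewhere.  Both effects are recorded by the weight
    [dist x y `^ al * q m (V x + V y) `^ (1 - al)].  It is jointly concave, so
    the image under [P] of a function dominated by it is again dominated by it,
    at the transport cost and at the value [s'] of [V x + V y] after the drift,
    where [s' <= s - phi s + 2 * K].  Thus the bound survives if
    [q m.+1 s' <= q m s] for [R0 < s] and [q m.+1 s' <= (1 + delta) * q m s]
    otherwise, where [(1 - rho) `^ al * (1 + delta) <= 1]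
    ([iter_pop_contraction]).  Such a family [q] is built in [lyapunov_family].
    For large [s] the drift is a fixed fraction of [phi s], worth a fixed time
    of the flow of [y' = phi y], whose trajectory from 1 is the inverse of
    [H_phi]; the Euler scheme of this equation replaces the flow throughout.
    With [r n] the value of [phi] after [n] Euler steps from 1, [q n] is at least
    [r n] while [q 0 s <= phi (1 + s)], and therefore [P^n f x - P^n f y] is at
    most [(1 + phi 1 + phi (V x) + phi (V y)) / r n `^ (1 - al)].

    Convergence.  The drift bounds the averages of [phi (V _)] along the first
    steps of the chain ([occupation_bound]), so [P^n f x] differs from the
    average of [P^(n + j) f x] over [j] by a multiple of
    [(1 + V x) / r n `^ (1 - al)], however long the average ([averaging_rate]).
    Long averages forget where they start, so [P^n f x] is a Cauchy sequence in
    [n], with that rate ([cesaro_limit]).  Its limit does not depend on [x] and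
    is the mean of [f] under a law, because the space of laws is complete
    ([lipschitz1_limit_measure]).  This law is stationary, and it is the only one
    by dominated convergence.  The bound on the mean of [phi (V _)] is obtained by
    integrating the drift of the truncations of [V] ([stationary_moment]), and
    [rate_H_phi_inv] compares [r n] with the rate of the theorem. *)

Set Implicit Arguments.
Unset Strict Implicit.
Unset Printing Implicit Defensive.

Import Order.TTheory GRing.Theory Num.Theory.
Import numFieldNormedType.Exports.

Local Open Scope classical_set_scope.
Local Open Scope ring_scope.

(** * Concave growth and the Euler scheme of [y' = phi y] *)

Section ConcaveGrowth.
Context (R : realType).
Variable phi : R -> R.
Hypothesis phi_concave : forall t x y : R, 0 <= t -> t <= 1 -> 0 <= x -> 0 <= y ->
  t * phi x + (1 - t) * phi y <= phi (t * x + (1 - t) * y).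
Hypothesis phi_lt : forall x y : R, 0 <= x -> x < y -> phi x < phi y.
Hypothesis phi0 : phi 0 = 0.

Lemma phi_le (x y : R) : 0 <= x -> x <= y -> phi x <= phi y.
Proof.
move=> x0; rewrite le_eqVlt => /predU1P[->//|xy].
exact/ltW/phi_lt.
Qed.

Lemma phi_gt0 (x : R) : 0 < x -> 0 < phi x.
Proof. by move=> x0; rewrite -phi0 phi_lt. Qed.

Lemma phi_ge0 (x : R) : 0 <= x -> 0 <= phi x.
Proof. by move=> x0; rewrite -phi0 phi_le. Qed.

(** As [phi 0 = 0], concavity makes [phi x / x] nonincreasing. *)
Lemma phi_scale (x y : R) : 0 <= x -> x <= y -> x * phi y <= y * phi x.
Proof.
move=> x0; rewrite le_eqVlt => /predU1P[->//|xy].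
have y0 : 0 < y by exact: le_lt_trans xy.
have t0 : 0 <= x / y by rewrite divr_ge0// ltW.
have t1 : x / y <= 1 by rewrite ler_pdivrMr// mul1r ltW.
have := phi_concave t0 t1 (ltW y0) (lexx 0).
rewrite phi0 !mulr0 !addr0 divfK ?gt_eqF// => h.
have := ler_wpM2l (ltW y0) h.
by rewrite mulrA mulrCA divff ?gt_eqF// mulr1.
Qed.

Lemma phi_subadd (x y : R) : 0 <= x -> 0 <= y -> phi (x + y) <= phi x + phi y.
Proof.
move=> x0 y0.
have [xy|xy] := ltP 0 (x + y); last first.
  have -> : x = 0 by lra.
  have -> : y = 0 by lra.
  by rewrite addr0 phi0 addr0.
have h1 : x * phi (x + y) <= (x + y) * phi x by apply: phi_scale => //; lra.
have h2 : y * phi (x + y) <= (x + y) * phi y by apply: phi_scale => //; lra.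
by rewrite -(ler_pM2l xy); nra.
Qed.

Lemma phi_chord (x y z : R) : 0 <= x -> x < y -> y < z ->
  (phi z - phi y) / (z - y) <= (phi y - phi x) / (y - x).
Proof.
move=> x0 xy yz.
have xz : 0 < z - x by lra.
have t0 : 0 <= (z - y) / (z - x) by rewrite divr_ge0//; lra.
have t1 : (z - y) / (z - x) <= 1 by rewrite ler_pdivrMr//; lra.
have z0 : 0 <= z by lra.
have := phi_concave t0 t1 x0 z0.
set t := (z - y) / (z - x) in t0 t1 *.
have e : t * (z - x) = z - y by rewrite /t divfK ?gt_eqF.
have -> : t * x + (1 - t) * z = y by lra.
move=> /(ler_wpM2r (ltW xz)).
have -> : (t * phi x + (1 - t) * phi z) * (z - x) =
  t * (z - x) * phi x + ((z - x) - t * (z - x)) * phi z by ring.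
rewrite e => h.
by rewrite ler_pdivrMr ?subr_gt0// mulrAC ler_pdivlMr ?subr_gt0//; lra.
Qed.

(** A supergradient of nonnegative slope at every interior point.  Unlike
    concavity, this is inherited at once by compositions, and it is what Jensen's
    inequality needs: the supporting line can be integrated. *)
Definition supported (g : R -> R) := forall y0, 0 < y0 ->
  exists2 p, 0 <= p & forall y, 0 <= y -> g y <= g y0 + p * (y - y0).

(** The largest slope of a chord to the right of [y0] is a supergradient, being
    at most the slope of every chord to the left. *)
Lemma phi_supported : supported phi.
Proof.
move=> y0 y00.
pose S := [set (phi y - phi y0) / (y - y0) | y in [set y | y0 < y]].
have lub y : 0 <= y -> y < y0 -> ubound S ((phi y0 - phi y) / (y0 - y)).
  by move=> y1 y2 _ [z /= z0 <-]; exact: phi_chord.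
have supS : has_sup S.
  split; first by exists ((phi (y0 + 1) - phi y0) / ((y0 + 1) - y0)); exists (y0 + 1) => //=; lra.
  by exists ((phi y0 - phi 0) / (y0 - 0)); exact: lub.
exists (sup S).
  apply: le_trans (ub_le_sup supS.2 _); last by exists (y0 + 1) => //=; lra.
  rewrite divr_ge0//; last by lra.
  rewrite subr_ge0; apply: phi_le; lra.
move=> y y1; have [yy|yy|->] := ltgtP y y0; last by rewrite subrr mulr0 addr0.
- have h : sup S <= (phi y0 - phi y) / (y0 - y) by apply: ge_sup (lub _ _ _) => //; exact: supS.1.
  move: h; rewrite ler_pdivlMr ?subr_gt0// => h; lra.
- have h : (phi y - phi y0) / (y - y0) <= sup S by apply: ub_le_sup supS.2 _ _; exists y.
  move: h; rewrite ler_pdivrMr ?subr_gt0// => h; lra.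
Qed.

Lemma supported_comp (g h : R -> R) :
  (forall y, 0 < y -> 0 < h y) -> (forall y, 0 <= y -> 0 <= h y) ->
  supported g -> supported h -> supported (g \o h).
Proof.
move=> hgt hge sg sh y0 y00.
have [p p0 gp] := sg _ (hgt _ y00).
have [r r0 hr] := sh _ y00.
exists (p * r) => [|y y1 /=]; first exact: mulr_ge0.
apply: le_trans (gp _ (hge _ y1)) _; rewrite lerD2l -mulrA ler_wpM2l//.
by have := hr _ y1; lra.
Qed.

Section Euler.
Variable k : R.
Hypothesis k0 : 0 < k.

(** One Euler step of the flow of [y' = phi y]; iterates of [step] replace the
    flow itself, whose value after time [t] from [y] is [H^-1(H y + t)]. *)
Definition step (y : R) := y + k * phi y.

Notation F m := (iter m step).

Lemma step_ge (y : R) : 0 <= y -> y <= step y.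
Proof. by move=> y0; rewrite lerDl mulr_ge0 ?phi_ge0// ltW. Qed.

Lemma iter_step_ge m (y : R) : 0 <= y -> y <= F m y.
Proof.
move=> y0; elim: m => //= m ih.
by apply: (le_trans ih); apply: step_ge; exact: le_trans ih.
Qed.

Lemma step_le (x y : R) : 0 <= x -> x <= y -> step x <= step y.
Proof. by move=> x0 xy; rewrite lerD// ler_pM2l// phi_le. Qed.

Lemma iter_step_le m (x y : R) : 0 <= x -> x <= y -> F m x <= F m y.
Proof.
move=> x0 xy; elim: m => //= m ih.
by apply: step_le => //; apply: le_trans (iter_step_ge m x0).
Qed.

Lemma step_supported : supported step.
Proof.
move=> y0 y00; have [p p0 hp] := phi_supported y00.
exists (1 + k * p) => [|y y1]; first by rewrite addr_ge0// mulr_ge0// ltW.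
by have := hp _ y1; rewrite -(ler_pM2l k0) /step; lra.
Qed.

Lemma iter_step_supported m : supported (F m).
Proof.
elim: m => [|m ih]; first by move=> y0 _; exists 1 => //= y _; lra.
apply: (@supported_comp step (F m)) => //; last exact: step_supported.
- by move=> y y0; apply: lt_le_trans (iter_step_ge m (ltW y0)).
- by move=> y y0; apply: le_trans (iter_step_ge m y0).
Qed.

Lemma iter1_ge1 m : 1 <= F m 1. Proof. exact: iter_step_ge. Qed.

Lemma iter1_ge0 m : 0 <= F m 1. Proof. exact: le_trans (iter1_ge1 m). Qed.

Lemma rate_gt0 m : 0 < phi (F m 1).
Proof. by apply/phi_gt0/(lt_le_trans _ (iter1_ge1 m)). Qed.

Lemma iter1_leS m n : (m <= n)%N -> F m 1 <= F n 1.
Proof.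
move=> /subnK <-; rewrite iterD.
exact: iter_step_ge (iter1_ge0 m).
Qed.

(** As [phi y / y] is nonincreasing, a step multiplies [phi y] by at most
    [step y / y = 1 + k * (phi y / y)], and [phi y / y <= phi 1] for [1 <= y]. *)
Lemma rateS m : phi (F m.+1 1) <= (1 + k * phi 1) * phi (F m 1).
Proof.
set y := F m 1; rewrite iterS -/y.
have y1 : 1 <= y := iter1_ge1 m.
have y0 : 0 < y by lra.
have h1 : y * phi (step y) <= step y * phi y.
  by apply: phi_scale; [exact: ltW|exact/step_ge/ltW].
have h2 : 1 * phi y <= y * phi 1 by apply: phi_scale.
rewrite -(ler_pM2l y0); apply: (le_trans h1); rewrite /step.
have : k * phi y * phi y <= k * (y * phi 1) * phi y.
  by rewrite ler_wpM2r ?phi_ge0 ?(ltW y0)// ler_pM2l//; lra.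
lra.
Qed.

Lemma rateD m j : phi (F (m + j) 1) <= (1 + k * phi 1) ^+ j * phi (F m 1).
Proof.
elim: j => [|j ih]; first by rewrite addn0 expr0 mul1r.
rewrite addnS; apply: (le_trans (rateS _)); rewrite exprS -mulrA ler_wpM2l//.
by rewrite addr_ge0// mulr_ge0 ?phi_ge0// ltW.
Qed.

Lemma iter1_ge_lin j : 1 + j%:R * (k * phi 1) <= F j 1.
Proof.
elim: j => [|j ih] /=; first by rewrite mul0r addr0.
have : k * phi 1 <= k * phi (F j 1) by rewrite ler_pM2l// phi_le// iter1_ge1.
by rewrite -natr1 /step; lra.
Qed.

Lemma iter1_sub_le m j :
  F (m + j) 1 - F m 1 <= (j%:R * k) * ((1 + k * phi 1) ^+ j * phi (F m 1)).
Proof.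
set B := _ ^+ j * _.
suff h i : (i <= j)%N -> F (m + i) 1 - F m 1 <= i%:R * k * B by exact: h.
elim: i => [_|i ih ij]; first by rewrite addn0 subrr !mul0r.
rewrite addnS iterS /step -natr1.
have hB : phi (F (m + i) 1) <= B.
  apply: (le_trans (rateD m i)); rewrite /B ler_pM2r ?rate_gt0//.
  by rewrite ler_weXn2l ?(ltnW ij)// lerDl mulr_ge0 ?phi_ge0// ltW.
have := ih (ltnW ij); have : k * phi (F (m + i) 1) <= k * B by rewrite ler_pM2l.
lra.
Qed.

(** A point lying [j] steps of size [k * phi z] below [z] does not overtake [z]
    within [j] steps, because below [z] the steps are shorter. *)
Lemma iter_step_catchup (z z' : R) j : 0 <= z' ->
  z' + j%:R * k * phi z <= z -> 0 <= z -> iter j step z' <= z.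
Proof.
move=> z0 h z1.
have kz : 0 <= k * phi z by rewrite mulr_ge0 ?phi_ge0// ltW.
suff H i : (i <= j)%N -> iter i step z' <= z' + i%:R * k * phi z.
  by apply: le_trans h; exact: H.
elim: i => [_|i ih ij]; first by rewrite !mul0r addr0.
have iz := ih (ltnW ij); have w0 := iter_step_ge i z0.
rewrite iterS; move: iz w0; set w := iter i step z' => iz w0.
have ij' : i%:R * k * phi z <= j%:R * k * phi z.
  by rewrite -!mulrA ler_wpM2r// ler_nat ltnW.
have : k * phi w <= k * phi z by rewrite ler_pM2l// phi_le//; lra.
rewrite -natr1 /step; lra.
Qed.

(** By [iter_step_catchup] the trajectory of [z'] needs more than [j.+1] steps to
    overtake [z], so at time [m] that of [z] is still ahead of that of [z'] at
    time [m.+1 + j]; each of the [j] steps in excess has at least the length of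
    a step from the trajectory of [1]. *)
Lemma iter_step_gain (z z' : R) j m : 1 <= z' -> 1 <= z ->
  z' + j.+1%:R * k * phi z <= z ->
  iter m.+1 step z' + j%:R * k * phi (iter m.+1 step 1) <= iter m step z.
Proof.
move=> z1' z1 h.
have z0' : 0 <= z' by lra.
have z0 : 0 <= z by lra.
have := iter_step_le m (le_trans z0' (iter_step_ge j.+1 z0'))
  (iter_step_catchup z0' h z0).
rewrite -iterD addnS -addSn; apply: le_trans.
have Fz : iter m.+1 step 1 <= iter m.+1 step z' by exact: iter_step_le.
elim: j {h} => [|j ih]; first by rewrite addn0 !mul0r addr0.
rewrite addnS [leRHS]iterS -natr1 [leRHS]/step.
have : k * phi (iter m.+1 step 1) <= k * phi (iter (m.+1 + j) step z').
  rewrite ler_pM2l// phi_le ?iter1_ge0// (le_trans Fz)// addnC iterD.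
  by rewrite iter_step_ge// (le_trans (iter1_ge0 m.+1)).
lra.
Qed.

End Euler.

(** Starting from [1 + u] instead of [1] is worth a fixed amount of time of the
    flow of [y' = phi y], about [u / phi 1].  That time takes [j] steps with
    [j * k] bounded, during which the rate grows by at most
    [(1 + k * phi 1) ^+ j <= expR (j * k * phi 1)].  The resulting [M] depends
    neither on [k] nor on [m]; the step [k] will be chosen after it. *)
Lemma excursion_bound (u : R) : 0 <= u -> exists2 M, 0 < M &
  forall k m, 0 < k -> k <= 1 ->
    iter m (step k) (1 + u) - iter m (step k) 1 <= M * phi (iter m (step k) 1).
Proof.
move=> u0; have p1 : 0 < phi 1 by exact: phi_gt0.
have up : 0 <= u / phi 1 by rewrite divr_ge0// ltW.
exists ((u / phi 1 + 1) * expR (u + phi 1)).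
  by rewrite mulr_gt0 ?expR_gt0// ltr_wpDl.
move=> k m k0 k1; have kp : 0 < k * phi 1 by rewrite mulr_gt0.
pose j := (Num.truncn (u / (k * phi 1))).+1.
have jl : u <= j%:R * (k * phi 1).
  by rewrite -ler_pdivrMr// ltW// truncnS_gt.
have ju : j%:R * k <= u / phi 1 + 1.
  have : (Num.truncn (u / (k * phi 1)))%:R <= u / (k * phi 1).
    by rewrite truncn_le// divr_ge0// ltW.
  rewrite -natr1 ler_pdivlMr// mulrDl mul1r => h.
  rewrite lerD// ler_pdivlMr//; lra.
apply: le_trans (_ : iter (m + j) (step k) 1 - iter m (step k) 1 <= _).
  rewrite lerD2r iterD iter_step_le//; first lra.
  by apply: le_trans (iter1_ge_lin k0 j); rewrite lerD2l.
apply: le_trans (iter1_sub_le k0 m j) _.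
rewrite mulrA ler_wpM2r ?(ltW (rate_gt0 k0 m))//.
apply: ler_pM => //.
- by rewrite mulr_ge0// ltW.
- by rewrite exprn_ge0// addr_ge0// ltW.
- apply: (@le_trans _ _ (expR (k * phi 1) ^+ j)).
    by rewrite lerXn2r ?nnegrE ?expR_ge0 ?addr_ge0 ?(ltW kp)// expR_ge1Dx.
  rewrite -expRM_natl ler_expR.
  have := ler_wpM2r (ltW p1) ju; rewrite mulrDl divfK ?gt_eqF// mul1r.
  lra.
Qed.

Section Family.
Variables (k L : R).
Hypotheses (k0 : 0 < k) (L0 : 0 < L).

Notation y m := (iter m (step k) 1).

(** A time-dependent weight that neither the drift nor an excursion can
    increase.  The natural candidate is the second branch, [phi] along the flow
    from [1 + s]: outside the small set the drift pays for one unit of time.  A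
    return to the small set may however multiply it by a large constant.  The
    first branch repairs this: for bounded [s] and large [L] it is nearly equal
    to [phi (y m)], whatever [s] is. *)
Definition lyapunov m (s : R) :=
  Num.min ((iter m (step k) (1 + s) - y m) / L + phi (y m))
          (phi (iter m (step k) (1 + s))).

Lemma lyapunov_supported m (s0 : R) : 0 <= s0 -> exists2 p, 0 <= p &
  forall s, 0 <= s -> lyapunov m s <= lyapunov m s0 + p * (s - s0).
Proof.
move=> s00; have s1 : 0 < 1 + s0 by lra.
have [p p0 hp] := iter_step_supported k0 m s1.
have [r r0 hr] : exists2 r, 0 <= r & forall z, 0 <= z ->
    phi (iter m (step k) z) <= phi (iter m (step k) (1 + s0)) + r * (z - (1 + s0)).
  apply: (@supported_comp phi (iter m (step k))) s1.
  - by move=> z z0; apply: lt_le_trans (iter_step_ge k0 m (ltW z0)).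
  - by move=> z z0; apply: le_trans (iter_step_ge k0 m z0).
  - exact: phi_supported.
  - exact: iter_step_supported.
rewrite {2}/lyapunov; set a := _ / L + _; set b := phi _.
have [ab|ba] := leP a b.
- exists (p / L) => [|s s2]; first by rewrite divr_ge0// ltW.
  rewrite /lyapunov ge_min /a; apply/orP; left.
  have s3 : 0 <= 1 + s by lra.
  have Li : 0 < L^-1 by rewrite invr_gt0.
  have := hp _ s3; rewrite -(ler_pM2r Li); lra.
- exists r => // s s2; rewrite /lyapunov ge_min; apply/orP; right.
  have s3 : 0 <= 1 + s by lra.
  have := hr _ s3; rewrite -/b; lra.
Qed.

Lemma rate_le_lyapunov m s : 0 <= s -> phi (y m) <= lyapunov m s.
Proof.
move=> s0; have h : y m <= iter m (step k) (1 + s).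
  by apply: iter_step_le => //; lra.
rewrite /lyapunov le_min phi_le ?iter1_ge0// andbT lerDr.
by rewrite divr_ge0// ?subr_ge0// ltW.
Qed.

Lemma lyapunov0_le s : lyapunov 0 s <= phi (1 + s).
Proof. by rewrite /lyapunov /= ge_min lexx orbT. Qed.

(** Away from the small set the drift is worth [j.+1] Euler steps.  One of them
    pays for the decrement of the time index, the other [j] for the decrease of
    [phi (y m)]. *)
Lemma lyapunov_drift m j s s' : 0 <= s -> 0 <= s' -> L * phi 1 <= 1 + j%:R ->
  s' + j.+1%:R * k * phi (1 + s) <= s ->
  lyapunov m.+1 s' <= lyapunov m s.
Proof.
move=> s0 s0' hj hs.
have z1 : 1 <= 1 + s by lra.
have z1' : 1 <= 1 + s' by lra.
have hz : 1 + s' + j.+1%:R * k * phi (1 + s) <= 1 + s by lra.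
have gain := iter_step_gain k0 m z1' z1 hz.
have yS : y m.+1 = y m + k * phi (y m) by [].
have yge : 0 <= phi (y m) by apply/ltW/rate_gt0.
have jy : 0 <= j%:R * k * phi (y m.+1).
  by rewrite mulr_ge0 ?(ltW (rate_gt0 k0 _))// mulr_ge0// ltW.
rewrite /lyapunov le_min; apply/andP; split; rewrite ge_min; apply/orP.
- left; have h1 := rateS k0 m.
  have clear a b : (a / L + b) * L = a + b * L by rewrite mulrDl divfK ?gt_eqF.
  rewrite -(ler_pM2r L0) !clear.
  have h2 : k * phi (y m) * (L * phi 1) <= k * phi (y m) * (1 + j%:R).
    by rewrite ler_wpM2l// mulr_ge0// ltW.
  have h3 := ler_wpM2r (ltW L0) h1.
  have h4 : j%:R * k * phi (y m) <= j%:R * k * phi (y m.+1).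
    rewrite ler_wpM2l// ?mulr_ge0// ?(ltW k0)//.
    by rewrite phi_le ?iter1_ge0// iter1_leS.
  lra.
- right; apply: phi_le; last by lra.
  by apply: le_trans (iter_step_ge k0 _ _); lra.
Qed.

(** At the bounded value [s'] the first branch exceeds the rate at time [m.+1] by a
    factor at most [1 + M / L]; the rate at time [m] is smaller by a factor at most
    [1 + k * phi 1], and is a lower bound of the weight at [s]. *)
Lemma lyapunov_excursion (M R1 : R) m s s' : 0 <= R1 ->
  (forall m, iter m (step k) (1 + R1) - y m <= M * phi (y m)) ->
  0 <= s -> 0 <= s' -> s' <= R1 ->
  lyapunov m.+1 s' <= (1 + M / L) * (1 + k * phi 1) * lyapunov m s.
Proof.
move=> R1ge hM s0 s0' sR.
have q0 : 0 <= phi (y m.+1) by apply/ltW/rate_gt0.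
have M0 : 0 <= M.
  rewrite leNgt; apply/negP => M0; have := hM m.
  have : M * phi (y m) < 0 by rewrite nmulr_rlt0// rate_gt0.
  have : y m <= iter m (step k) (1 + R1) by apply: iter_step_le => //; lra.
  lra.
apply: (@le_trans _ _ ((1 + M / L) * phi (y m.+1))).
  rewrite /lyapunov ge_min; apply/orP; left.
  have -> : (1 + M / L) * phi (y m.+1) = M * phi (y m.+1) / L + phi (y m.+1).
    by rewrite mulrDl mul1r addrC mulrAC.
  rewrite lerD2r ler_pM2r ?invr_gt0//.
  apply: le_trans (hM _); rewrite lerD2r.
  by apply: iter_step_le => //; lra.
rewrite -mulrA ler_wpM2l//; first by rewrite addr_ge0// divr_ge0// ltW.
apply: le_trans (rateS k0 m) _; rewrite ler_wpM2l ?rate_le_lyapunov//.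
by rewrite addr_ge0// mulr_ge0 ?phi_ge0// ltW.
Qed.

End Family.

(** The constants are chosen in the order [M], [L], [j], [k].  The value of [L]
    makes excursions cheap, [j] is the number of steps by which the drift must
    outrun time for that [L], and [k] is small enough for the drift to be worth
    [j.+1] steps. *)
Lemma lyapunov_family (R0 K delta : R) : 0 < R0 -> 0 <= K -> 2 * K < phi R0 ->
  0 < delta -> exists k L, [/\ 0 < k, 0 < L,
    (forall m s s', R0 < s -> 0 <= s' -> s' <= s - phi s + 2 * K ->
       lyapunov k L m.+1 s' <= lyapunov k L m s) &
    (forall m s s', 0 <= s -> s <= R0 -> 0 <= s' -> s' <= s - phi s + 2 * K ->
       lyapunov k L m.+1 s' <= (1 + delta) * lyapunov k L m s)].
Proof.
move=> R00 K0 KR d0.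
have pR : 0 < phi R0 by exact: phi_gt0.
have p1 : 0 < phi 1 by exact: phi_gt0.
(* [c0] is the part of [phi s] left once [2 * K] is paid for, [R0 <= s]; the
   factor [R0 / (1 + R0)] turns [phi (1 + s)] into [phi s]. *)
pose c0 := 1 - 2 * K / phi R0; pose c := c0 * (R0 / (1 + R0)).
have c00 : 0 < c0 by rewrite subr_gt0 ltr_pdivrMr// mul1r.
have c01 : c0 <= 1 by rewrite gerBl divr_ge0 ?(ltW pR)// mulr_ge0.
have r0 : 0 < R0 / (1 + R0) by rewrite divr_gt0//; lra.
have r1 : R0 / (1 + R0) <= 1 by rewrite ler_pdivrMr//; lra.
have cgt0 : 0 < c by rewrite mulr_gt0.
have c1 : c <= 1 by rewrite /c; nra.
have [M M0 hM] := @excursion_bound (R0 + 2 * K) ltac:(nra).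
pose eta := Num.min delta 1 / 3.
have eta0 : 0 < eta by rewrite divr_gt0// lt_min d0 ltr01.
have etad : 3 * eta <= delta.
  by rewrite /eta mulrC divfK// ge_min lexx.
have eta1 : 3 * eta <= 1 by rewrite /eta mulrC divfK// ge_min lexx orbT.
pose L := M / eta; have L0 : 0 < L by rewrite divr_gt0.
pose j := (Num.truncn (L * phi 1 + phi 1 / eta)).+1.
have j0 : 0 < j%:R :> R by rewrite ltr0n.
have jL : L * phi 1 + phi 1 / eta < j%:R by rewrite truncnS_gt.
have Lp : 0 < L * phi 1 by rewrite mulr_gt0.
have pe : 0 < phi 1 / eta by rewrite divr_gt0.
pose k := c / j.+1%:R.
have jS : 0 < j.+1%:R :> R by rewrite ltr0n.
have k0 : 0 < k by rewrite divr_gt0.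
have kj : j.+1%:R * k = c by rewrite /k mulrC divfK// gt_eqF.
have k1 : k <= 1.
  by rewrite /k ler_pdivrMr// mul1r (le_trans c1)// ler1n.
have keta : k * phi 1 <= eta.
  rewrite /k mulrAC ler_pdivrMr// -natr1.
  have : phi 1 <= eta * j%:R by rewrite -ler_pdivrMl// mulrC; lra.
  have : c * phi 1 <= phi 1 by rewrite ler_piMl// ltW.
  lra.
exists k, L; split => //.
- move=> m s s' Rs s0' hs.
  have s0 : 0 < s by lra.
  apply: (@lyapunov_drift k L k0 L0 m j) => //; [lra|lra|].
  rewrite kj.
  have ps : phi R0 <= phi s by apply: phi_le; lra.
  have h1 : 2 * K <= (1 - c0) * phi s.
    have -> : 1 - c0 = 2 * K / phi R0 by rewrite /c0; lra.
    rewrite mulrAC ler_pdivlMr// ler_wpM2l// mulr_ge0//.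
  have h2 : c * phi (1 + s) <= c0 * phi s.
    rewrite /c -mulrA ler_pM2l// mulrAC ler_pdivrMr; last lra.
    have : s * phi (1 + s) <= (1 + s) * phi s by apply: phi_scale; lra.
    have : 0 <= phi s by lra.
    move=> p0 h; rewrite -(ler_pM2l s0).
    have : R0 * (s * phi (1 + s)) <= R0 * ((1 + s) * phi s) by rewrite ler_pM2l.
    have : phi s * R0 <= phi s * s by rewrite ler_wpM2l// ltW.
    lra.
  lra.
- move=> m s s' s0 sR s0' hs.
  have R1 : 0 <= R0 + 2 * K by nra.
  have sR' : s' <= R0 + 2 * K by have := phi_ge0 s0; lra.
  have h := @lyapunov_excursion k L k0 L0 M (R0 + 2 * K) m s s' R1 (fun m => hM k m k0 k1) s0 s0' sR'.
  apply: (le_trans h); rewrite ler_wpM2r//.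
    exact: le_trans (ltW (rate_gt0 k0 m)) (rate_le_lyapunov k0 L0 m s0).
  have -> : M / L = eta by rewrite /L invf_div mulrCA divff ?mulr1// gt_eqF.
  have kp : 0 <= k * phi 1 by rewrite mulr_ge0 ?(ltW p1)// ltW.
  nra.
Qed.

End ConcaveGrowth.

(** * The inverse functions in the rate *)

Section InverseRate.
Context (R : realType).
Variable phi : R -> R.
Hypothesis phi_concave : forall t x y : R, 0 <= t -> t <= 1 -> 0 <= x -> 0 <= y ->
  t * phi x + (1 - t) * phi y <= phi (t * x + (1 - t) * y).
Hypothesis phi_lt : forall x y : R, 0 <= x -> x < y -> phi x < phi y.
Hypothesis phi0 : phi 0 = 0.
Hypothesis phi_cont : {within `[0, +oo[, continuous phi}.

Local Notation mu := (@lebesgue_measure R).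

Lemma phi_inv_lt (v r : R) : 0 <= v -> phi x @[x --> +oo] --> +oo ->
  phi_inv phi v < r -> 0 < r /\ v < phi r.
Proof.
move=> v0 phioo.
have [b [b0 vb]] : exists b, 0 <= b /\ v <= phi b.
  move/cvgryPge : phioo => /(_ v) [M [Mreal hM]].
  exists (Num.max 0 M + 1); split; first by rewrite addr_ge0// le_max lexx.
  by apply: hM; rewrite ltr_pwDr// le_max lexx orbT.
have [c] : exists2 c, c \in `[0, b] & phi c = v.
  apply: IVT => //.
    apply: continuous_subspaceW phi_cont.
    by move=> z /=; rewrite !in_itv/= => /andP[->].
  by rewrite phi0 ge_min v0 /= le_max vb orbT.
rewrite in_itv/= => /andP[c0 _] <-.
rewrite /phi_inv pinvKV; last by rewrite inE/= in_itv/= c0.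
  by move=> cr; split; [exact: le_lt_trans cr|exact: phi_lt].
move=> x y; rewrite !inE/= !in_itv/= !andbT => x0 y0 xy.
have [h|h|//] := ltgtP x y.
- by have := phi_lt x0 h; rewrite xy ltxx.
- by have := phi_lt y0 h; rewrite xy ltxx.
Qed.

Let inv_phi_cont : {within `[1, +oo[, continuous (fun u => (phi u)^-1)}.
Proof.
apply/subspace_continuousP => x /=; rewrite in_itv/= andbT => x1.
have x0 : 0 < x by exact: lt_le_trans x1.
apply: cvgV; first by rewrite gt_eqF// (phi_gt0 phi_lt phi0).
have c : {within `[1, +oo[, continuous phi}.
  apply: continuous_subspaceW phi_cont.
  by move=> z /=; rewrite !in_itv/= !andbT; exact: le_trans.
have /subspace_continuousP := c; move=> /(_ x); apply.
by rewrite /= in_itv/= x1.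
Qed.

Lemma inv_phi_integrable (b : R) :
  mu.-integrable `[1, b] (EFin \o (fun u => (phi u)^-1)).
Proof.
apply: continuous_compact_integrable; first exact: segment_compact.
apply: continuous_subspaceW inv_phi_cont.
by move=> z /=; rewrite !in_itv/= => /andP[->].
Qed.

Lemma H_phi1 : H_phi phi 1 = 0.
Proof. by rewrite /H_phi set_itv1 Rintegral_set1. Qed.

Lemma H_phi_sub_ge (x y : R) : 1 <= x -> x <= y ->
  (y - x) / phi y <= H_phi phi y - H_phi phi x.
Proof.
move=> x1 xy; rewrite /H_phi Rintegral_itvB ?bnd_simp//; last exact: inv_phi_integrable.
have itv z : z \in `]x, y] -> 0 < z /\ z <= y.
  rewrite in_itv/= => /andP[xz zy]; split => //.
  by apply: lt_trans xz; exact: lt_le_trans x1.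
have -> : (y - x) / phi y = \int[mu]_(t in `]x, y]) (phi y)^-1.
  rewrite Rintegral_cst// mulrC; congr (_ * _).
  rewrite /= lebesgue_measure_itv/= lte_fin.
  by move: xy; rewrite le_eqVlt => /predU1P[->|->//]; rewrite ltxx subrr.
apply: le_Rintegral => //.
- apply: measurable_bounded_integrable => //.
    by rewrite /= lebesgue_measure_itv/=; case: ifP => //; rewrite -EFinB ltry.
  exact: bounded_cst.
- apply: integrableS (inv_phi_integrable y) => //.
  by move=> z /=; rewrite !in_itv/= => /andP[xz ->]; rewrite andbT ltW// (le_lt_trans x1).
- move=> z /itv[z0 zy].
  rewrite lef_pV2 ?posrE ?(phi_gt0 phi_lt phi0)//; last exact: lt_le_trans zy.
  by apply: (phi_le phi_lt) => //; exact: ltW.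
Qed.

Lemma H_phi_lt (x y : R) : 1 <= x -> x < y -> H_phi phi x < H_phi phi y.
Proof.
move=> x1 xy; rewrite -subr_gt0; apply: lt_le_trans (H_phi_sub_ge x1 (ltW xy)).
by rewrite divr_gt0 ?subr_gt0// (phi_gt0 phi_lt phi0)//; lra.
Qed.

Lemma H_phi_inv_le (v b : R) : 0 <= v -> 1 <= b -> v <= H_phi phi b ->
  1 <= H_phi_inv phi v /\ H_phi_inv phi v <= b.
Proof.
move=> v0 b1 vb.
have [c] : exists2 c, c \in `[1, b] & H_phi phi c = v.
  apply: IVT => //.
    exact: (parameterized_integral_continuous b1 (inv_phi_integrable b)).
  by rewrite H_phi1 ge_min v0 /= le_max vb orbT.
rewrite in_itv/= => /andP[c1 cb] <-.
rewrite /H_phi_inv pinvKV//; last by rewrite inE/= in_itv/= c1.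
move=> x y; rewrite !inE/= !in_itv/= !andbT => x1 y1 xy.
have [h|h|//] := ltgtP x y.
- by have := H_phi_lt x1 h; rewrite xy ltxx.
- by have := H_phi_lt y1 h; rewrite xy ltxx.
Qed.

(** Each Euler step [y -> y + k * phi y] raises [H_phi] by at least
    [k * phi y / phi (y + k * phi y)], and the two values of [phi] are
    comparable by concavity; so the iterates grow like [H_phi^-1]. *)
Lemma H_phi_iter_ge (k : R) (n : nat) : 0 < k ->
  k / (1 + k * phi 1) * n%:R <= H_phi phi (iter n (step phi k) 1).
Proof.
move=> k0; elim: n => [|n ih]; first by rewrite mulr0 H_phi1.
set y := iter n (step phi k) 1 in ih *.
have y1 : 1 <= y := iter1_ge1 phi_lt phi0 k0 n.
have yS : y <= step phi k y by apply: step_ge => //; lra.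
have py : 0 < phi y by apply: phi_gt0 => //; lra.
have pSy : 0 < phi (step phi k y) by apply: phi_gt0 => //; lra.
have p1 : 0 < phi 1 by exact: phi_gt0.
have := H_phi_sub_ge y1 yS; rewrite iterS -/y.
have -> : step phi k y - y = k * phi y by rewrite /step; lra.
have d0 : 0 < 1 + k * phi 1 by rewrite addr_gt0// mulr_gt0.
have : k / (1 + k * phi 1) <= k * phi y / phi (step phi k y).
  rewrite ler_pdivlMr// mulrAC ler_pdivrMr// -mulrA ler_pM2l// mulrC.
  exact: (rateS phi_concave phi_lt phi0 k0 n).
rewrite -natr1; lra.
Qed.

(** The lower bound [phi 1] serves the exponents [1 - eps <= 0], for which the
    rate of the theorem is not monotone in the right direction. *)
Lemma rate_H_phi_inv (k : R) (n : nat) : 0 < k ->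
  phi 1 <= phi (H_phi_inv phi (k / (1 + k * phi 1) * n%:R)) <=
    phi (iter n (step phi k) 1).
Proof.
move=> k0; have p1 : 0 < phi 1 by exact: phi_gt0.
have v0 : 0 <= k / (1 + k * phi 1) * n%:R.
  by rewrite mulr_ge0// divr_ge0 ?(ltW k0)// addr_ge0// mulr_ge0// ltW.
have y1 := iter1_ge1 phi_lt phi0 k0 n.
have [h1 h2] := H_phi_inv_le v0 y1 (H_phi_iter_ge n k0).
by rewrite !(phi_le phi_lt)//; lra.
Qed.

End InverseRate.

(** * Kantorovich-Rubinstein duality on finite spaces *)

Section Sublinear.
Context (R : realType) (U : lmodType R).
Implicit Types (p : U -> R) (u v w : U).

(** Only the half of positive homogeneity that is immediate for an infimum over a
    set of dual variables; [sublinearZ] recovers the other half. *)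
Definition sublinear p := (forall u v, p (u + v) <= p u + p v) /\
  (forall (t : R) v, 0 < t -> p (t *: v) <= t * p v).

Lemma sublinear0 p : sublinear p -> p 0 = 0.
Proof.
move=> [_ pZ]; have := pZ 2 0 ltac:(by []); have := pZ 2^-1 0 ltac:(by []).
by rewrite !scaler0; lra.
Qed.

Lemma sublinearZ p (t : R) v : sublinear p -> 0 <= t -> p (t *: v) = t * p v.
Proof.
move=> sp; rewrite le_eqVlt => /predU1P[<-|t0].
  by rewrite scale0r mul0r sublinear0.
apply/le_anti; rewrite sp.2//=.
have := sp.2 t^-1 (t *: v); rewrite invr_gt0 => /(_ t0).
by rewrite scalerA mulVf ?gt_eqF// scale1r ler_pdivlMl.
Qed.

Lemma sublinear_opp_ge p v : sublinear p -> - p (- v) <= p v.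
Proof.
move=> sp; have := sp.1 v (- v); rewrite subrr sublinear0//; lra.
Qed.

(** The one-dimensional Hahn-Banach step, without subspaces: the largest
    sublinear functional below [p] that is additive along [w] with slope
    [p w]. *)
Lemma sublinear_flatten p w : sublinear p -> exists p',
  [/\ sublinear p', forall v, p' v <= p v & p' (- w) <= - p w].
Proof.
move=> sp.
pose S v := [set p (v + t *: w) - t * p w | t in [set t : R | 0 <= t]].
have lbS v : lbound (S v) (- p (- v)).
  move=> _ [t /= t0 <-]; rewrite -sublinearZ//.
  have := sp.1 (v + t *: w) (- v); rewrite addrAC subrr add0r; lra.
have infS v : has_inf (S v).
  split; last by exists (- p (- v)).
  by exists (p (v + 0 *: w) - 0 * p w); exists 0 => //=.
have Sle v t : 0 <= t -> inf (S v) <= p (v + t *: w) - t * p w.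
  by move=> t0; apply: (ge_inf (infS v).2); exists t.
have Sge v x : (forall t, 0 <= t -> x <= p (v + t *: w) - t * p w) ->
    x <= inf (S v).
  by move=> h; apply: (lb_le_inf (infS v).1) => _ [t t0 <-]; exact: h.
exists (fun v => inf (S v)); split.
- split=> [u v|t v t0].
    rewrite -lerBlDr; apply: (Sge) => t t0; rewrite lerBlDr -lerBlDl.
    apply: (Sge) => s s0; rewrite lerBlDl.
    apply: le_trans (Sle _ (t + s) _) _; first exact: addr_ge0.
    rewrite scalerDl addrACA; have := sp.1 (u + t *: w) (v + s *: w); lra.
  rewrite -ler_pdivrMl//; apply: (Sge) => s s0.
  rewrite ler_pdivrMl//.
  apply: le_trans (Sle _ (t * s) _) _; first by rewrite mulr_ge0// ltW.
  rewrite -scalerA -scalerDr; have := sp.2 t (v + s *: w) t0; lra.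
- move=> v; apply: le_trans (Sle v 0 (lexx _)) _.
  by rewrite scale0r addr0 mul0r subr0.
- apply: le_trans (Sle _ 1 ler01) _.
  by rewrite scale1r addNr sublinear0// mul1r sub0r.
Qed.

(** Flattening along a basis leaves a linear functional below [p]; this is how the
    Hahn-Banach theorem is used here, in finite dimension. *)
Lemma sublinear_flatten_seq p (ws : seq U) : sublinear p -> exists p',
  [/\ sublinear p', forall v, p' v <= p v &
      forall w, w \in ws -> p' (- w) = - p' w].
Proof.
move=> sp; elim: ws => [|w ws [q [sq qp qws]]]; first by exists p; split.
have [r [sr rq rw]] := sublinear_flatten w sq.
have flat v : q (- v) <= - q v -> r (- v) = - r v.
  move=> qv; have := sublinear_opp_ge v sr.
  have := sublinear_opp_ge (- v) sr; rewrite opprK.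
  have := rq v; have := rq (- v); lra.
exists r; split=> [//|v|v]; first exact: le_trans (rq v) (qp v).
rewrite inE => /predU1P[->|/qws qv]; last by apply: flat; rewrite qv.
have := sublinear_opp_ge w sr; have := rq w.
have := sublinear_opp_ge (- w) sr; rewrite opprK; lra.
Qed.

Lemma sublinear_addZ p w v (t : R) : sublinear p -> p (- w) = - p w ->
  p (v + t *: w) = p v + t * p w.
Proof.
move=> sp pw.
have tw s : p (s *: w) = s * p w.
  have [s0|s0] := leP 0 s; first exact: sublinearZ.
  by rewrite -[s]opprK scaleNr -scalerN sublinearZ ?pw//; lra.
apply/le_anti/andP; split; first by rewrite -tw sp.1.
have := sp.1 (v + t *: w) (- (t *: w)).
by rewrite addrK -scaleNr tw; lra.
Qed.

Lemma sublinear_sum p (I : Type) (r : seq I) (w : I -> U) (t : I -> R) :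
  sublinear p -> (forall i, p (- w i) = - p (w i)) ->
  p (\sum_(i <- r) t i *: w i) = \sum_(i <- r) t i * p (w i).
Proof.
move=> sp pw; elim: r => [|i r ih]; first by rewrite !big_nil sublinear0.
by rewrite !big_cons addrC sublinear_addZ// ih addrC.
Qed.

End Sublinear.

Section FiniteTransport.
Context (R : realType) (n : nat).
Notation I := 'I_n.+1.
Variables (mu nu : I -> R).
Hypotheses (mu_ge0 : forall i, 0 <= mu i) (nu_ge0 : forall i, 0 <= nu i).
Hypotheses (mu1 : \sum_i mu i = 1) (nu1 : \sum_i nu i = 1).

Let dual_set (h : 'M[R]_n.+1) := [set \sum_i mu i * f.1 i + \sum_j nu j * f.2 j |
   f in [set f : (I -> R) * (I -> R) | forall i j, h i j <= f.1 i + f.2 j]].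

(** The value of the linear programme dual to maximizing [\sum_ij P i j * h i j]
    over the transport plans [P] from [mu] to [nu]. *)
Definition dual_price h := inf (dual_set h).

Let dual_lb h : has_inf (dual_set h).
Proof.
pose m := \big[Num.max/0]_i \big[Num.max/0]_j h i j.
have hm i j : h i j <= m.
  apply: le_trans (le_bigmax _ _ i); exact: (le_bigmax _ (fun j => h i j) j).
split.
  exists (\sum_i mu i * m + \sum_j nu j * 0); exists (fun=> m, fun=> 0) => // i j /=.
  by rewrite addr0.
exists (\sum_i \sum_j mu i * nu j * h i j) => _ [[f g] /= fg <-].
have -> : \sum_i mu i * f i + \sum_j nu j * g j =
    \sum_i \sum_j mu i * nu j * (f i + g j).
  under [RHS]eq_bigr do under eq_bigr do rewrite mulrDr.
  under [RHS]eq_bigr do rewrite big_split.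
  rewrite big_split/=; congr (_ + _).
    apply: eq_bigr => i _; rewrite -[LHS]mulr1 -nu1 mulr_sumr.
    by apply: eq_bigr => j _; ring.
  rewrite exchange_big/=; apply: eq_bigr => j _.
  rewrite -[LHS]mulr1 -mu1 mulr_sumr.
  by apply: eq_bigr => i _; ring.
apply: ler_sum => i _; apply: ler_sum => j _.
by rewrite ler_wpM2l// mulr_ge0.
Qed.

Let dual_price_le (h : 'M[R]_n.+1) (f g : I -> R) : (forall i j, h i j <= f i + g j) ->
  dual_price h <= \sum_i mu i * f i + \sum_j nu j * g j.
Proof. by move=> fg; apply: (ge_inf (dual_lb h).2); exists (f, g). Qed.

Let le_dual_price (h : 'M[R]_n.+1) x : (forall f g : I -> R, (forall i j, h i j <= f i + g j) ->
  x <= \sum_i mu i * f i + \sum_j nu j * g j) -> x <= dual_price h.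
Proof.
by move=> H; apply: (lb_le_inf (dual_lb h).1) => _ [[f g] /= fg <-]; exact: H.
Qed.

Lemma dual_price_sublinear : sublinear dual_price.
Proof.
split=> [u v|t v t0].
- rewrite -lerBlDr; apply: le_dual_price => f g fg; rewrite lerBlDr -lerBlDl.
  apply: le_dual_price => f' g' fg'; rewrite lerBlDl.
  apply: le_trans (@dual_price_le _ (fun i => f i + f' i) (fun i => g i + g' i) _) _.
    by move=> i j; rewrite mxE; have := fg i j; have := fg' i j; lra.
  under eq_bigr do rewrite mulrDr; under [X in _ + X <= _]eq_bigr do rewrite mulrDr.
  by rewrite !big_split/=; lra.
- rewrite -ler_pdivrMl//; apply: le_dual_price => f g fg; rewrite ler_pdivrMl//.
  apply: le_trans (@dual_price_le _ (fun i => t * f i) (fun i => t * g i) _) _.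
    by move=> i j; rewrite mxE -mulrDr ler_pM2l.
  under eq_bigr do rewrite mulrCA; under [X in _ + X <= _]eq_bigr do rewrite mulrCA.
  by rewrite -!mulr_sumr mulrDr.
Qed.

(** Kantorovich-Rubinstein duality on a finite pseudometric space.  A linear
    functional below the sublinear [dual_price] is integration against a
    transport plan; taking it to agree with [dual_price] at [- c] makes the
    plan optimal, and the triangle inequality turns a pair of dual potentials
    into a single one. *)
Lemma finite_kantorovich_rubinstein (c : I -> I -> R) (C : R) :
  (forall i, c i i = 0) -> (forall i j k, c i k <= c i j + c j k) ->
  (forall u : I -> R, (forall i j, u i - u j <= c i j) ->
     \sum_i mu i * u i - \sum_i nu i * u i <= C) ->
  exists P : I -> I -> R, [/\ forall i j, 0 <= P i j,
    forall i, \sum_j P i j = mu i, forall j, \sum_i P i j = nu j &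
    \sum_i \sum_j P i j * c i j <= C].
Proof.
move=> cii ctri hC.
pose cm : 'M[R]_n.+1 := \matrix_(i, j) c i j.
pose delta (ij : I * I) : 'M[R]_n.+1 := delta_mx ij.1 ij.2.
have sd := dual_price_sublinear.
have [p0 [sp0 p0d p0c]] := sublinear_flatten (- cm) sd.
have [p [sp pp0 pdelta]] := sublinear_flatten_seq [seq delta ij | ij : I * I] sp0.
have pN ij : p (- delta ij) = - p (delta ij) by apply: pdelta; apply/mapP; exists ij; rewrite ?mem_enum.
have pE (h : 'M[R]_n.+1) : p h = \sum_i \sum_j h i j * p (delta (i, j)).
  rewrite pair_big/= -(sublinear_sum _ _ sp pN).
  by congr p; rewrite [h in LHS]matrix_sum_delta pair_big.
have pd h : p h <= dual_price h by exact: le_trans (pp0 h) (p0d h).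
exists (fun i j => p (delta (i, j))); split.
- move=> i j; rewrite -oppr_le0 -pN; apply: (le_trans (pd _)).
  apply: le_trans (@dual_price_le _ (fun=> 0) (fun=> 0) _) _.
    by move=> i' j'; rewrite !mxE addr0 oppr_le0; case: (_ && _).
  by rewrite !big1 ?addr0// => k _; rewrite mulr0.
- have main (s : R) i : s * \sum_j p (delta (i, j)) <= s * mu i.
    have -> : s * \sum_j p (delta (i, j)) =
        p (\matrix_(i', j) (if i' == i then s else 0)).
      rewrite [RHS]pE [RHS](bigD1 i)//= [X in _ + X]big1 ?addr0; last first.
        by move=> k ki; apply: big1 => j _; rewrite mxE (negbTE ki) mul0r.
      by rewrite mulr_sumr; apply: eq_bigr => j _; rewrite mxE eqxx.
    apply: (le_trans (pd _)).
    apply: le_trans (@dual_price_le _ (fun k => if k == i then s else 0) (fun=> 0) _) _.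
      by move=> k j; rewrite mxE addr0.
    rewrite [X in _ + X]big1 ?addr0; last by move=> k _; rewrite mulr0.
    rewrite (bigD1 i)//= eqxx big1 ?addr0; first by rewrite mulrC.
    by move=> k /negbTE ->; rewrite mulr0.
  by move=> i; have := main 1 i; have := main (- 1) i; lra.
- have main (s : R) j : s * \sum_i p (delta (i, j)) <= s * nu j.
    have -> : s * \sum_i p (delta (i, j)) =
        p (\matrix_(i, j') (if j' == j then s else 0)).
      rewrite [RHS]pE [RHS]exchange_big [RHS](bigD1 j)//= [X in _ + X]big1 ?addr0; last first.
        by move=> k ki; apply: big1 => i _; rewrite mxE (negbTE ki) mul0r.
      by rewrite mulr_sumr; apply: eq_bigr => i _; rewrite mxE eqxx.
    apply: (le_trans (pd _)).
    apply: le_trans (@dual_price_le _ (fun=> 0) (fun k => if k == j then s else 0) _) _.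
      by move=> k k'; rewrite mxE add0r.
    rewrite [X in X + _]big1 ?add0r; last by move=> k _; rewrite mulr0.
    rewrite (bigD1 j)//= eqxx big1 ?addr0; first by rewrite mulrC.
    by move=> k /negbTE ->; rewrite mulr0.
  by move=> j; have := main 1 j; have := main (- 1) j; lra.
have pcm : p cm = \sum_i \sum_j p (delta (i, j)) * c i j.
  rewrite pE; apply: eq_bigr => i _; apply: eq_bigr => j _.
  by rewrite mxE mulrC.
rewrite -pcm; apply: (le_trans (pp0 _)).
move: p0c; rewrite opprK => p0c; apply: (le_trans p0c).
rewrite lerNl; apply: le_dual_price => f g fg.
have {}fg i j : - f i - g j <= c i j by have := fg i j; rewrite !mxE; lra.
(* The [c]-transform of [g]: 1-Lipschitz, above [- f] and below [g]. *)
pose u i := \big[Num.min/c i ord0 + g ord0]_j (c i j + g j).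
have ule i j : u i <= c i j + g j by exact: bigmin_le.
have leu i x : (forall j, x <= c i j + g j) -> x <= u i.
  by move=> h; rewrite /u; apply/bigmin_geP.
have uLip i j : u i - u j <= c i j.
  rewrite lerBlDr -lerBlDl; apply: leu => k.
  by have := ule i k; have := ctri i j k; lra.
have := hC u uLip.
have h1 : \sum_i mu i * - f i <= \sum_i mu i * u i.
  apply: ler_sum => i _; rewrite ler_wpM2l//; apply: leu => j.
  by have := fg i j; lra.
have h2 : \sum_i nu i * - g i <= \sum_i nu i * - u i.
  apply: ler_sum => i _; rewrite ler_wpM2l//.
  by have := ule i i; rewrite cii; lra.
have sumN (m w : I -> R) : \sum_i m i * - w i = - \sum_i m i * w i.
  by rewrite -sumrN; apply: eq_bigr => i _; rewrite mulrN.
by move: h1 h2; rewrite !sumN; lra.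
Qed.

End FiniteTransport.

(** * Means under a probability *)

Section Means.
Context d (T : measurableType d) (R : realType).
Implicit Types (mu nu : probability T R) (f g : T -> R).

Lemma bounded_integrable mu f (M : R) : measurable_fun setT f ->
  (forall x, `|f x| <= M) -> mu.-integrable setT (EFin \o f).
Proof.
move=> mf fM; apply: measurable_bounded_integrable => //.
  by rewrite /= probability_setT ltry.
exists M; split; first exact: num_real.
by move=> y My x _; apply: le_trans (fM x) _; exact: ltW.
Qed.

Lemma mean_cst mu (c : R) : \int[mu]_x c = c.
Proof. by rewrite Rintegral_cst//= probability_setT mulr1. Qed.

Lemma cst_integrable mu (c : R) : mu.-integrable setT (EFin \o (fun=> c)).
Proof. exact: finite_measure_integrable_cst. Qed.

Lemma integrable_add mu f g : mu.-integrable setT (EFin \o f) ->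
  mu.-integrable setT (EFin \o g) ->
  mu.-integrable setT (EFin \o (fun x => f x + g x)).
Proof.
move=> fi gi; rewrite (_ : _ \o _ = ((EFin \o f) \+ (EFin \o g))%E).
  exact: integrableD.
by apply/funext => x /=; rewrite EFinD.
Qed.

Lemma integrable_sub mu f g : mu.-integrable setT (EFin \o f) ->
  mu.-integrable setT (EFin \o g) ->
  mu.-integrable setT (EFin \o (fun x => f x - g x)).
Proof.
move=> fi gi; rewrite (_ : _ \o _ = ((EFin \o f) \- (EFin \o g))%E).
  exact: integrableB.
by apply/funext => x /=; rewrite EFinB.
Qed.

Lemma integrable_scale mu (c : R) f : mu.-integrable setT (EFin \o f) ->
  mu.-integrable setT (EFin \o (fun x => c * f x)).
Proof.
move=> fi; rewrite (_ : _ \o _ = (fun x => c%:E * (EFin \o f) x)%E).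
  exact: integrableZl.
by apply/funext => x /=; rewrite EFinM.
Qed.

Lemma mean_cvg mu (fn : nat -> T -> R) f (M : R) :
  (forall n, measurable_fun setT (fn n)) -> measurable_fun setT f ->
  (forall n x, `|fn n x| <= M) ->
  (forall x, fn n x @[n --> \oo] --> f x) ->
  \int[mu]_x fn n x @[n --> \oo] --> \int[mu]_x f x.
Proof.
move=> mfn mf fnM fnf.
have mfn' n : measurable_fun setT (EFin \o fn n) by exact/measurable_EFinP.
have mf' : measurable_fun setT (EFin \o f) by exact/measurable_EFinP.
have cv : {ae mu, forall x, setT x -> (EFin \o fn n) x @[n --> \oo] --> (EFin \o f) x}.
  by apply: aeW => x _; apply: cvg_EFin; [exact: nearW|exact: fnf].
have dom : {ae mu, forall x n, setT x -> (`|(EFin \o fn n) x| <= (EFin \o (fun=> M)) x)%E}.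
  by apply: aeW => x n _; rewrite lee_fin.
have [fi _ h] := dominated_convergence measurableT mfn' mf' cv (cst_integrable mu M) dom.
by apply: fine_cvg; rewrite /Rintegral fineK//; exact: integrable_fin_num.
Qed.

(** Normalizing a measure of total mass 1 does not change it, but yields the
    bundled structure. *)
Lemma probability_of_measure (m : {measure set T -> \bar R}) : m setT = 1%E ->
  exists P : probability T R, forall A, P A = m A.
Proof.
move=> m1; exists (mnormalize m (dirac point)) => A.
rewrite /= /mnormalize m1 onee_eq0 /=.
by rewrite invr1 mule1.
Qed.

End Means.

(** * Means of discrete variables and of images *)

Section MoreMeans.
Context d (T : measurableType d) (R : realType).
Implicit Types (mu nu : probability T R).

Lemma mean_sum mu (I : Type) (r : seq I) (f : I -> T -> R) :
  (forall i, mu.-integrable setT (EFin \o f i)) ->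
  \int[mu]_x (\sum_(i <- r) f i x) = \sum_(i <- r) \int[mu]_x f i x /\
  mu.-integrable setT (EFin \o (fun x => \sum_(i <- r) f i x)).
Proof.
move=> fi; elim: r => [|i r [ih1 ih2]].
  rewrite big_nil; under eq_Rintegral do rewrite big_nil.
  rewrite mean_cst; split => //.
  rewrite (_ : _ \o _ = EFin \o (fun=> 0)); first exact: cst_integrable.
  by apply/funext => x /=; rewrite big_nil.
rewrite big_cons; under eq_Rintegral do rewrite big_cons.
rewrite RintegralD// ih1; split => //.
rewrite (_ : _ \o _ = EFin \o (fun x => f i x + \sum_(i <- r) f i x)).
  exact: integrable_add.
by apply/funext => x /=; rewrite big_cons.
Qed.

Lemma mean_indic mu (A : set T) : measurable A -> \int[mu]_x \1_A x = fine (mu A).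
Proof. by move=> mA; rewrite /Rintegral integral_indic// setIT. Qed.

Lemma indic_integrable mu (A : set T) : measurable A ->
  mu.-integrable setT (EFin \o \1_A).
Proof.
move=> mA; apply: (@bounded_integrable _ _ _ mu _ 1) => // x.
by rewrite indicE; case: (x \in A); rewrite ?normr1 ?normr0.
Qed.

Lemma mean_finite_partition mu (I : finType) (A : I -> set T) (g : I -> R) (h : T -> R) :
  (forall i, measurable (A i)) -> (forall x, h x = \sum_i g i * \1_(A i) x) ->
  \int[mu]_x h x = \sum_i g i * fine (mu (A i)).
Proof.
move=> mA hE; under eq_Rintegral do rewrite hE.
have gi i : mu.-integrable setT (EFin \o (fun x => g i * \1_(A i) x)).
  exact/integrable_scale/indic_integrable.
rewrite (mean_sum _ gi).1; apply: eq_bigr => i _.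
by rewrite RintegralZl ?mean_indic//; exact: indic_integrable.
Qed.

Lemma mean_nat_index mu (X : T -> nat) (n : nat) (g : nat -> R) :
  measurable_fun setT X -> (forall x, (X x < n)%N) ->
  \int[mu]_x g (X x) = \sum_(i < n) g i * fine (mu (X @^-1` [set (i : nat)])).
Proof.
move=> mX Xn.
apply: (@mean_finite_partition mu _ (fun i : 'I_n => X @^-1` [set (i : nat)])) => [i|x].
  by rewrite -[X in measurable X]setTI; exact: mX.
rewrite (bigD1 (Ordinal (Xn x)))//= big1 ?addr0.
  by rewrite indicE mem_set// mulr1.
move=> i ix; rewrite indicE memNset ?mulr0// => /= xi.
by move/eqP: ix; apply; apply/val_inj; rewrite /= xi.
Qed.

Lemma mean_nat_index2 mu (X Y : T -> nat) (n : nat) (g : nat -> nat -> R) :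
  measurable_fun setT X -> measurable_fun setT Y ->
  (forall x, (X x < n)%N) -> (forall x, (Y x < n)%N) ->
  \int[mu]_x g (X x) (Y x) = \sum_(i < n) \sum_(j < n)
    g i j * fine (mu (X @^-1` [set (i : nat)] `&` Y @^-1` [set (j : nat)])).
Proof.
move=> mX mY Xn Yn; rewrite pair_big/=.
apply: (@mean_finite_partition mu _ (fun ij : 'I_n * 'I_n =>
  X @^-1` [set (ij.1 : nat)] `&` Y @^-1` [set (ij.2 : nat)]) (fun ij => g ij.1 ij.2)) => [ij|x].
  by apply: measurableI; rewrite -[X in measurable X]setTI; [exact: mX|exact: mY].
rewrite (bigD1 (Ordinal (Xn x), Ordinal (Yn x)))//= big1 ?addr0.
  by rewrite indicE mem_set// mulr1.
move=> [i j] ij; rewrite indicE memNset ?mulr0// => -[/= Xi Yj].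
by move/eqP: ij; apply; congr (_, _); apply/val_inj.
Qed.

End MoreMeans.

(** Only the law of [p] matters, so [m] need not be syntactically a pushforward;
    the marginals of a coupling are the case of interest. *)
Lemma mean_image d d' (T : measurableType d) (T' : measurableType d') (R : realType)
    (l : probability T' R) (m : probability T R) (p : T' -> T) (f : T -> R) :
  measurable_fun setT p -> (forall A, measurable A -> l (p @^-1` A) = m A) ->
  m.-integrable setT (EFin \o f) ->
  l.-integrable setT (EFin \o (f \o p)) /\ \int[l]_z f (p z) = \int[m]_x f x.
Proof.
move=> mp pE fi.
have mf : measurable_fun setT f by apply/measurable_EFinP; exact: measurable_int fi.
pose pm : {mfun T' >-> T} := mfun_Sub (mem_set mp).
have pmE A : measurable A -> pushforward l pm A = m A by exact: pE.
have fpi : l.-integrable setT (EFin \o (f \o p)).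
  apply/integrableP; split; first exact/measurable_EFinP/measurableT_comp.
  have /integrableP[_] := fi; apply: le_lt_trans.
  rewrite -(@eq_measure_integral _ _ _ setT m (pushforward l pm))//; last first.
    by move=> A mA _; exact: pmE.
  rewrite ge0_integral_pushforward//.
  exact/measurableT_comp/measurable_EFinP.
split => //; rewrite /Rintegral; congr fine.
rewrite -(@eq_measure_integral _ _ _ setT m (pushforward l pm))//; last first.
  by move=> A mA _; exact: pmE.
rewrite (@integral_pushforward _ _ _ _ _ pm)//.
exact/measurable_EFinP.
Qed.

Section CouplingMeans.
Context d (T : measurableType d) (R : realType).
Variables (mu nu : probability T R) (l : probability (T * T)%type R).
Hypothesis cl : coupling mu nu l.

Lemma mean_fst (f : T -> R) : mu.-integrable setT (EFin \o f) ->
  l.-integrable setT (EFin \o (f \o fst)) /\ \int[l]_z f z.1 = \int[mu]_x f x.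
Proof.
apply: mean_image => // A mA.
have [<- _] := cl mA; congr (l _).
by apply/seteqP; split => -[x y] //= [].
Qed.

Lemma mean_snd (f : T -> R) : nu.-integrable setT (EFin \o f) ->
  l.-integrable setT (EFin \o (f \o snd)) /\ \int[l]_z f z.2 = \int[nu]_x f x.
Proof.
apply: mean_image => // A mA.
have [_ <-] := cl mA; congr (l _).
by apply/seteqP; split => -[x y] //= [].
Qed.

End CouplingMeans.

(** * Borel measurability on a separable metric space *)

Section MetricMeasurability.
Context (R : realType) (E : completeMetricType R).
Hypothesis hsep : separable E.
Notation dist x y := (@mdist R E x y).

(** By symmetry of the distance the one-sided inequality bounds [`|f x - f y|]. *)
Definition lipschitz1 (f : E -> R) := forall x y, f x - f y <= dist x y.

Lemma dense_sequence : exists a : nat -> E, forall x e, 0 < e ->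
  exists n, dist (a n) x < e.
Proof.
have [S cS dS] := hsep.
have S0 : S !=set0.
  have [x [_ Sx]] := dS setT (ex_intro _ point I) openT.
  by exists x.
have /pcard_surjP [g gS] := cS.
exists g => x e e0.
have [y [yx Sy]] := dS (ball x e)^° (ex_intro _ x (nbhsx_ballx _ _ e0)) (@open_interior _ _).
have [n _ gn] := gS y Sy.
exists n; rewrite gn metric_sym.
by have := interior_subset yx; rewrite ballEmdist.
Qed.

Lemma lipschitz1_dist (x : E) : lipschitz1 (fun y => dist x y).
Proof. by move=> y z; rewrite lerBlDr addrC (metric_sym y z) metric_triangle. Qed.

Lemma open_measurable_borel (U : set E) : open U -> measurable (U : set (borel E)).
Proof. by move=> oU; exact: sub_sigma_algebra. Qed.

Lemma open_dist_lt (f : E -> R) (r : R) : lipschitz1 f -> open [set x | f x < r].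
Proof.
move=> lf; rewrite openE => x /= fx; apply/nbhs_ballP.
exists (r - f x); rewrite /= ?subr_gt0// => y; rewrite ballEmdist/= => xy.
by have := lf y x; rewrite metric_sym; lra.
Qed.

Lemma lipschitz1_measurable (f : E -> R) : lipschitz1 f ->
  measurable_fun setT (f : borel E -> R).
Proof.
move=> lf; apply: (measurability _ (RGenInftyO.measurableE R)) => //.
move=> _ [_ [r ->] <-]; rewrite setTI; apply: open_measurable_borel.
rewrite (_ : _ @^-1` _ = [set x | f x < r]); first exact: open_dist_lt.
by apply/seteqP; split => x /=; rewrite in_itv.
Qed.

(** The sigma-algebra on pairs is the product one, so continuity of the distance
    is not enough: [dist x y < r] is written as a countable union of conditions
    on [dist (a n) x + dist (a n) y] over a dense sequence [a]. *)
Lemma dist_measurable : measurable_fun setT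
  (fun z : borel E * borel E => dist z.1 z.2).
Proof.
have [a ha] := dense_sequence.
apply: (measurability _ (RGenInftyO.measurableE R)) => //.
move=> _ [_ [r ->] <-]; rewrite setTI.
rewrite (_ : _ @^-1` _ = \bigcup_n
    ((fun z : borel E * borel E => dist (a n) z.1 + dist (a n) z.2) @^-1` `]-oo, r[)).
  apply: bigcupT_measurable => n; rewrite -[X in measurable X]setTI.
  have ma : measurable_fun setT (fun y : borel E => dist (a n) y).
    by apply: lipschitz1_measurable; apply: lipschitz1_dist.
  apply: measurable_funD => //.
  - exact: (measurableT_comp ma measurable_fst).
  - exact: (measurableT_comp ma measurable_snd).
apply/seteqP; split => -[x y] /=; rewrite in_itv/=.
  move=> xy; have e0 : 0 < (r - dist x y) / 2 by lra.
  have [n an] := ha x _ e0; exists n => //=; rewrite in_itv/=.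
  by have := metric_triangle (a n) x y; lra.
move=> [n _ /=]; rewrite in_itv/= => h.
by have := metric_triangle x (a n) y; rewrite (metric_sym x (a n)); lra.
Qed.

End MetricMeasurability.

(** * From transport plans between cells to couplings *)

Lemma measurable_fun_nat_index d d' (T : measurableType d) (T' : measurableType d')
    (iota : T -> nat) (g : nat -> T -> T') : measurable_fun setT iota ->
  (forall n, measurable_fun setT (g n)) ->
  measurable_fun setT (fun x => g (iota x) x).
Proof.
move=> mi mg _ B mB; rewrite setTI.
rewrite (_ : _ @^-1` B = \bigcup_n (iota @^-1` [set n] `&` g n @^-1` B)).
  apply: bigcupT_measurable => n; apply: measurableI.
    by rewrite -[X in measurable X]setTI; exact: mi.
  by rewrite -[X in measurable X]setTI; exact: mg.
apply/seteqP; split => [x /= h|x [n _ [/= <-]]//].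
by exists (iota x).
Qed.

Lemma measure_cells d (T : measurableType d) (R : realType)
    (m : probability T R) (iota : T -> nat) (n : nat) (A : set T) :
  measurable_fun setT iota -> (forall x, (iota x < n)%N) -> measurable A ->
  m A = (\sum_(i < n) m (A `&` iota @^-1` [set (i : nat)]))%E.
Proof.
move=> miota iota_lt mA; pose cell (i : nat) : set T := iota @^-1` [set i].
have mcell i : measurable (cell i).
  by rewrite /cell -[X in measurable X]setTI; exact: miota.
have AE : A = \big[setU/set0]_(i < n) (A `&` cell i).
  rewrite -(bigcup_mkord _ (fun i => A `&` cell i)).
  by apply/seteqP; split => [x Ax|x [i _ []]//]; exists (iota x) => //=.
rewrite {1}AE (measure_bigsetU m (F := fun i => A `&` cell i))//.
- by move=> i; exact: measurableI.
- apply/trivIsetP => i j _ _ ij; rewrite setIACA setIid.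
  rewrite (_ : cell i `&` cell j = set0) ?setI0//.
  by apply/seteqP; split => // x [/= xi xj]; rewrite -xi -xj eqxx in ij.
Qed.

Section PlanToCoupling.
Context d (T : measurableType d) (R : realType) (n : nat).
Variables (mu nu : probability T R) (iota : T -> nat) (P : nat -> nat -> R).
Hypothesis miota : measurable_fun setT iota.
Hypothesis iota_lt : forall x, (iota x < n)%N.

Let cell (i : nat) : set T := iota @^-1` [set i].

Hypothesis P_ge0 : forall i j, 0 <= P i j.
Hypothesis P_row : forall i, (i < n)%N -> \sum_(j < n) P i j = fine (mu (cell i)).
Hypothesis P_col : forall j, (j < n)%N -> \sum_(i < n) P i j = fine (nu (cell j)).

Let mcell i : measurable (cell i).
Proof. by rewrite /cell -[X in measurable X]setTI; exact: miota. Qed.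

Let mprodcell i j : measurable (cell i `*` cell j).
Proof. exact: measurableX. Qed.

Let weight i j : R := P i j / (fine (mu (cell i)) * fine (nu (cell j))).

Let weight_ge0 i j : 0 <= weight i j.
Proof. by rewrite divr_ge0// mulr_ge0// fine_ge0. Qed.

Let plan_measure : {measure set (T * T) -> \bar R} :=
  msum (fun i => msum (fun j =>
    mscale (NngNum (weight_ge0 i j)) (mrestr (mu \x nu)%E (mprodcell i j))) n) n.

Let plan_measureE (A B : set T) : measurable A -> measurable B ->
  plan_measure (A `*` B) = (\sum_(i < n) \sum_(j < n)
    weight i j * (fine (mu (A `&` cell i)) * fine (nu (B `&` cell j))))%:E.
Proof.
move=> mA mB; rewrite /plan_measure /= /msum -sumEFin; apply: eq_bigr => i _.
rewrite -sumEFin; apply: eq_bigr => j _.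
transitivity ((weight i j)%:E *
    (mu \x nu)%E ((A `*` B) `&` (cell i `*` cell j)))%E; first by [].
rewrite -setXI product_measure1E//; [|exact: measurableI..].
by rewrite !EFinM !fineK// fin_num_measure//; exact: measurableI.
Qed.

Let fine_sub0 (m : probability T R) (A B : set T) : measurable A -> measurable B ->
  fine (m B) = 0 -> fine (m (A `&` B)) = 0.
Proof.
move=> mA mB B0; apply/le_anti/andP; split; last exact: fine_ge0.
have mAB := measurableI _ _ mA mB.
rewrite -B0; apply: fine_le; [exact: fin_num_measure..|].
by apply: le_measure; rewrite ?inE.
Qed.

Let weight_row i j : (i < n)%N -> (j < n)%N ->
  weight i j * fine (nu (cell j)) = P i j / fine (mu (cell i)).
Proof.
move=> ni nj; have [nu0|nu0] := eqVneq (fine (nu (cell j))) 0.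
  rewrite nu0 mulr0.
  have : P i j <= 0.
    rewrite -nu0 -P_col// (bigD1 (Ordinal ni))//= lerDl.
    exact: sumr_ge0.
  move=> Ple; have P0 : P i j = 0 by apply/le_anti; rewrite Ple P_ge0.
  by rewrite P0 mul0r.
by rewrite /weight invfM mulrA divfK.
Qed.

Let weight_col i j : (i < n)%N -> (j < n)%N ->
  weight i j * fine (mu (cell i)) = P i j / fine (nu (cell j)).
Proof.
move=> ni nj; have [mu0|mu0] := eqVneq (fine (mu (cell i))) 0.
  rewrite mu0 mulr0.
  have : P i j <= 0.
    rewrite -mu0 -P_row// (bigD1 (Ordinal nj))//= lerDl.
    exact: sumr_ge0.
  move=> Ple; have P0 : P i j = 0 by apply/le_anti; rewrite Ple P_ge0.
  by rewrite P0 mul0r.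
by rewrite /weight invfM [in LHS]mulrA mulrAC divfK.
Qed.

(** Conditionally on the pair of cells, which is drawn from [P], the two
    coordinates are independent with the laws [mu] and [nu] conditioned on their
    cells. *)
Lemma coupling_of_plan : exists2 l, coupling mu nu l &
  forall i j, (i < n)%N -> (j < n)%N -> l (cell i `*` cell j) = (P i j)%:E.
Proof.
have muE A : measurable A -> plan_measure (A `*` setT) = mu A.
  move=> mA; rewrite plan_measureE//.
  rewrite [RHS](measure_cells mu miota iota_lt)// -sumEFin; apply: eq_bigr => i _.
  rewrite -[RHS]fineK; last by exact/fin_num_measure/measurableI/(mcell _).
  congr (_%:E); have [m0|m0] := eqVneq (fine (mu (cell i))) 0.
    by rewrite fine_sub0// big1// => j _; rewrite mul0r mulr0.
  rewrite -[RHS]mul1r -(divff m0) -{1}P_row// !mulr_suml.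
  apply: eq_bigr => j _.
  by rewrite setTI [X in _ * X]mulrC mulrA weight_row.
have nuE A : measurable A -> plan_measure (setT `*` A) = nu A.
  move=> mA; rewrite plan_measureE// exchange_big/=.
  rewrite [RHS](measure_cells nu miota iota_lt)// -sumEFin; apply: eq_bigr => j _.
  rewrite -[RHS]fineK; last by exact/fin_num_measure/measurableI/(mcell _).
  congr (_%:E); have [m0|m0] := eqVneq (fine (nu (cell j))) 0.
    by rewrite fine_sub0// big1// => i _; rewrite !mulr0.
  rewrite -[RHS]mul1r -(divff m0) -{1}P_col// !mulr_suml.
  apply: eq_bigr => i _.
  by rewrite setTI mulrA weight_col.
have p1 : plan_measure setT = 1%E.
  by rewrite -setXTT muE// probability_setT.
have [l lE] := probability_of_measure p1.
exists l => [A mA|i j ni nj]; first by split; rewrite lE ?muE// nuE.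
rewrite lE plan_measureE//; congr (_%:E).
have cellI k k' : cell k `&` cell k' = if k == k' then cell k else set0.
  have [->|kk'] := eqVneq k k'; first exact: setIid.
  by apply/seteqP; split => // x [/= xk xk']; rewrite -xk -xk' eqxx in kk'.
rewrite (bigD1 (Ordinal ni))//= [X in _ + X]big1 ?addr0; last first.
  move=> k ki; rewrite big1// => k' _; rewrite cellI.
  by rewrite -val_eqE eq_sym/= in ki; rewrite (negbTE ki) measure0/= mul0r mulr0.
rewrite (bigD1 (Ordinal nj))//= [X in _ + X]big1 ?addr0; last first.
  move=> k kj; rewrite [X in nu X]cellI.
  by rewrite -val_eqE eq_sym/= in kj; rewrite (negbTE kj) measure0/= !mulr0.
rewrite !setIid mulrCA weight_row// mulrC.
have [m0|m0] := eqVneq (fine (mu (cell i))) 0; last by rewrite divfK.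
rewrite m0 mulr0; apply/esym/le_anti; rewrite P_ge0 andbT.
by rewrite -m0 -P_row// (bigD1 (Ordinal nj))//= lerDl sumr_ge0.
Qed.

End PlanToCoupling.

(** * Quantization by finitely many centres *)

Section Quantization.
Context (R : realType) (E : completeMetricType R).
Notation dist x y := (@mdist R E x y).
Hypothesis dist_le1 : forall x y : E, dist x y <= 1.

Lemma lipschitz1_bounded (f : E -> R) : lipschitz1 f ->
  forall x, `|f x| <= `|f point| + 1.
Proof.
move=> lf x; have := lf x point; have := lf point x.
have := dist_le1 x point; have := dist_le1 point x.
have : f point <= `|f point| by exact: ler_norm.
have : - f point <= `|f point| by rewrite -normrN ler_norm.
by move=> *; rewrite ler_norml; apply/andP; split; lra.
Qed.

Lemma lipschitz1_integrable (mu : probability (borel E) R) (f : E -> R) :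
  lipschitz1 f -> mu.-integrable setT (EFin \o f).
Proof.
move=> lf; apply: (bounded_integrable mu _ (lipschitz1_bounded lf)).
exact: lipschitz1_measurable.
Qed.

Variable a : nat -> E.
Hypothesis a_dense : forall x e, 0 < e -> exists n, dist (a n) x < e.

(** Total and with values at most [N]: the points far from all the centres are
    sent to the centre [0].  Only finitely many distances are compared, hence the
    measurability. *)
Fixpoint center (e : R) (N : nat) (x : borel E) : nat :=
  if N is n.+1 then if dist (a n) x < e then n else center e n x else 0%N.

Lemma center_le e N x : (center e N x <= N)%N.
Proof.
by elim: N => //= n ih; case: ifP => // _; exact: leqW.
Qed.

Lemma center_measurable e N : measurable_fun setT (center e N).
Proof.
elim: N => [|n ih] /=; first exact: measurable_cst.
apply: measurable_fun_ifT => //.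
by apply: measurable_fun_ltr => //; apply: lipschitz1_measurable; apply: lipschitz1_dist.
Qed.

Lemma center_close e N n x : dist (a n) x < e -> (n < N)%N ->
  dist (a (center e N x)) x < e.
Proof.
move=> nx; elim: N => // N ih; rewrite ltnS leq_eqVlt => /predU1P[<-|nN] /=.
  by rewrite nx.
by case: ifP => // _; exact: ih.
Qed.

Lemma center_dist_measurable e N :
  measurable_fun setT (fun x : borel E => dist (a (center e N x)) x).
Proof.
apply: (@measurable_fun_nat_index _ _ _ _ (center e N) (fun n x => dist (a n) x)).
  exact: center_measurable.
by move=> n; apply: lipschitz1_measurable; apply: lipschitz1_dist.
Qed.

Lemma center_dist_integrable (mu : probability (borel E) R) e N :
  mu.-integrable setT (EFin \o (fun x : borel E => dist (a (center e N x)) x)).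
Proof.
apply: (@bounded_integrable _ _ _ mu _ 1); first exact: center_dist_measurable.
by move=> x; rewrite ger0_norm ?mdist_ge0.
Qed.

(** Points within [e] of one of the [N] centres are moved by less than [e].  Every
    other point is moved by at most 1, and these points disappear as [N] grows;
    taking the maximum with [e] makes the cost converge to [e] everywhere, so
    that dominated convergence applies. *)
Lemma quantization (mu : probability (borel E) R) (e : R) : 0 < e ->
  exists N0, forall N, (N0 <= N)%N ->
    \int[mu]_x dist (a (center e N x)) x <= 2 * e.
Proof.
move=> e0.
pose g N (x : borel E) := Num.max (dist (a (center e N x)) x) e.
have mg N : measurable_fun setT (g N).
  by apply: measurable_maxr => //; exact: center_dist_measurable.
have gM N x : `|g N x| <= 1 + e.
  rewrite ger0_norm; last by rewrite le_max (ltW e0) orbT.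
  by rewrite ge_max; have := dist_le1 (a (center e N x)) x; lra.
have gcvg x : g N x @[N --> \oo] --> e.
  have [n nx] := a_dense x e0.
  apply: cvg_near_cst; exists n.+1 => // N /= nN.
  by rewrite /g; apply/max_idPr/ltW; exact: center_close nx nN.
have := @mean_cvg _ _ _ mu g (fun=> e) (1 + e) mg (measurable_cst _) gM gcvg.
rewrite mean_cst => /cvgrPdist_lt /(_ e e0) [N0 _ hN].
exists N0 => N N0N; have := hN N N0N; rewrite /= ltr_norml => /andP[h _].
apply: le_trans (_ : \int[mu]_x g N x <= _); last lra.
apply: le_Rintegral => //; first exact: center_dist_integrable.
  exact: (bounded_integrable mu (mg N) (gM N)).
by move=> x _; rewrite le_max lexx.
Qed.

(** McShane extension from finitely many points. *)
Lemma mcshane (n : nat) (b : 'I_n.+1 -> E) (u : 'I_n.+1 -> R) :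
  (forall i j, u i - u j <= dist (b i) (b j)) ->
  exists2 f, lipschitz1 f & forall i x, `|f x - u i| <= dist (b i) x.
Proof.
move=> lu.
pose f x := \big[Num.min/u ord0 + dist (b ord0) x]_i (u i + dist (b i) x).
have fle i x : f x <= u i + dist (b i) x by exact: bigmin_le.
have lef c x : (forall i, c <= u i + dist (b i) x) -> c <= f x.
  by move=> h; rewrite /f; apply/bigmin_geP.
exists f => [x y|i x].
  rewrite lerBlDr -lerBlDl; apply: (lef) => i.
  by have := fle i x; have := metric_triangle (b i) y x; rewrite (metric_sym y x); lra.
rewrite ler_norml; apply/andP; split; last by have := fle i x; lra.
rewrite lerBrDr; apply: (lef) => j.
have := lu i j; have := metric_triangle (b i) x (b j).
by rewrite (metric_sym x (b j)); lra.
Qed.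

End Quantization.

(** * Kantorovich-Rubinstein duality *)

Section KantorovichRubinstein.
Context (R : realType) (E : completeMetricType R).
Notation dist x y := (@mdist R E x y).
Hypothesis hsep : separable E.
Hypothesis dist_le1 : forall x y : E, dist x y <= 1.

Lemma dist_integrable (l : probability (borel E * borel E)%type R) :
  l.-integrable setT (EFin \o (fun z => dist z.1 z.2)).
Proof.
apply: (@bounded_integrable _ _ _ l _ 1); first exact: dist_measurable.
by move=> z; rewrite ger0_norm ?mdist_ge0.
Qed.

Lemma mean_dist (l : probability (borel E * borel E)%type R) :
  (\int[l]_z (dist z.1 z.2)%:E)%E = (\int[l]_z dist z.1 z.2)%:E.
Proof.
by rewrite /Rintegral fineK//; exact: (integrable_fin_num _ (dist_integrable l)).
Qed.

Lemma wasserstein_coupling (mu nu : probability (borel E) R) (w e : R) :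
  (wasserstein mu nu <= w%:E)%E -> 0 < e ->
  exists2 l, coupling mu nu l & \int[l]_z dist z.1 z.2 <= w + e.
Proof.
move=> W e0.
have : (wasserstein mu nu < (w + e)%:E)%E.
  by apply: le_lt_trans W _; rewrite lte_fin ltrDl.
move=> /ereal_inf_lt [_ [l cl <-]]; rewrite mean_dist lte_fin => /ltW h.
by exists l.
Qed.

(** Both laws are quantized on the same centres, at cost [2 * e] each.  A potential
    on the centres extends to a 1-Lipschitz function by [mcshane], so the
    hypothesis passes to the quantized laws, with an error of [4 * e].  The
    optimal finite plan then gives a coupling of the original laws, and undoing
    the quantization of the two coordinates costs another [4 * e]. *)
Lemma kantorovich_rubinstein (mu nu : probability (borel E) R) (C : R) :
  (forall f : E -> R, lipschitz1 f -> \int[mu]_x f x - \int[nu]_x f x <= C) ->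
  (wasserstein mu nu <= C%:E)%E.
Proof.
move=> hC.
suff H e : 0 < e -> exists2 l, coupling mu nu l & \int[l]_z dist z.1 z.2 <= C + 8 * e.
  apply/lee_addgt0Pr => e e0.
  have e80 : 0 < e / 8 by lra.
  have [l cl hl] := H _ e80.
  apply: (@le_trans _ _ (\int[l]_z (dist z.1 z.2)%:E)%E).
    by apply: ereal_inf_lbound; exists l.
  by rewrite mean_dist -EFinD lee_fin; lra.
move=> e0.
have [a ha] := dense_sequence hsep.
have [N1 hN1] := quantization dist_le1 ha mu e0.
have [N2 hN2] := quantization dist_le1 ha nu e0.
pose N := maxn N1 N2; pose io := center a e N.
have qmu : \int[mu]_x dist (a (io x)) x <= 2 * e by apply: hN1; exact: leq_maxl.
have qnu : \int[nu]_x dist (a (io x)) x <= 2 * e by apply: hN2; exact: leq_maxr.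
have mio : measurable_fun setT io by exact: center_measurable.
have iolt x : (io x < N.+1)%N by rewrite ltnS center_le.
pose cell (i : nat) : set (borel E) := io @^-1` [set i].
have mcell i : measurable (cell i).
  by rewrite /cell -[X in measurable X]setTI; exact: mio.
pose ms (m : probability (borel E) R) (i : 'I_N.+1) := fine (m (cell i)).
have meanE (m : probability (borel E) R) (g : nat -> R) :
    \int[m]_x g (io x) = \sum_i ms m i * g i.
  by rewrite (mean_nat_index m g mio iolt); apply: eq_bigr => i _; rewrite mulrC.
have ms1 m : \sum_i ms m i = 1.
  have := meanE m (fun=> 1); rewrite mean_cst => ->.
  by apply: eq_bigr => i _; rewrite mulr1.
have ms0 m i : 0 <= ms m i by exact: fine_ge0.
have hu (u : 'I_N.+1 -> R) : (forall i j : 'I_N.+1, u i - u j <= dist (a i) (a j)) ->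
    \sum_i ms mu i * u i - \sum_i ms nu i * u i <= C + 4 * e.
  move=> lu; have [f lf fu] := mcshane lu.
  pose g i := u (inord i).
  have gE (m : probability (borel E) R) : \sum_i ms m i * u i = \int[m]_x g (io x).
    by rewrite meanE; apply: eq_bigr => i _; rewrite /g inord_val.
  have fg x : `|f x - g (io x)| <= dist (a (io x)) x.
    by have := fu (inord (io x)) x; rewrite inordK.
  have ig (m : probability (borel E) R) : m.-integrable setT (EFin \o (g \o io)).
    apply: (@bounded_integrable _ _ _ m _ (\sum_(i < N.+1) `|g i|)).
      exact: measurableT_comp.
    move=> x /=; rewrite (bigD1 (Ordinal (iolt x)))//= lerDl.
    by apply: sumr_ge0.
  have quant (m : probability (borel E) R) : \int[m]_x dist (a (io x)) x <= 2 * e ->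
      `|\int[m]_x f x - \int[m]_x g (io x)| <= 2 * e.
    move=> q; apply: le_trans q.
    have fi := lipschitz1_integrable dist_le1 m lf.
    rewrite -(RintegralB _ fi (ig m))//.
    have fgi : m.-integrable setT (EFin \o (fun x => f x - g (io x))).
      exact: integrable_sub.
    apply: (le_trans (le_normr_Rintegral _ fgi)) => //.
    apply: le_Rintegral => //.
    - by have := integrable_norm fgi.
    - exact: center_dist_integrable.
  have := quant mu qmu; have := quant nu qnu; rewrite !gE !ler_norml.
  move=> /andP[h1 h2] /andP[h3 h4]; have := hC f lf; lra.
have [P [P0 Prow Pcol Pcost]] :=
  finite_kantorovich_rubinstein (ms0 mu) (ms0 nu) (ms1 mu) (ms1 nu)
    (fun i => mdistxx (a i)) (fun i j k => metric_triangle (a i) (a j) (a k)) hu.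
pose P' i j := P (inord i) (inord j).
have [|||l cl lP] := @coupling_of_plan _ _ R N.+1 mu nu io P' mio iolt.
- by move=> i j; exact: P0.
- move=> i iN; rewrite -(inordK iN) -[RHS]Prow.
  by apply: eq_bigr => j _; rewrite /P' !inord_val.
- move=> j jN; rewrite -(inordK jN) -[RHS]Pcol.
  by apply: eq_bigr => i _; rewrite /P' !inord_val.
exists l => //.
pose D (x : borel E) := dist (a (io x)) x.
have Dmu := mean_fst cl (center_dist_integrable dist_le1 a mu e N).
have Dnu := mean_snd cl (center_dist_integrable dist_le1 a nu e N).
pose c (z : borel E * borel E) := dist (a (io z.1)) (a (io z.2)).
have mio1 : measurable_fun setT (io \o fst : borel E * borel E -> nat).
  exact: measurableT_comp.
have mio2 : measurable_fun setT (io \o snd : borel E * borel E -> nat).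
  exact: measurableT_comp.
have cmean : \int[l]_z c z <= C + 4 * e.
  rewrite (mean_nat_index2 l (fun i j => dist (a i) (a j)) mio1 mio2
    (fun z => iolt z.1) (fun z => iolt z.2)).
  apply: le_trans Pcost; apply: ler_sum => i _; apply: ler_sum => j _.
  rewrite (_ : _ `&` _ = cell i `*` cell j); last by apply/seteqP; split => -[].
  by rewrite lP//= /P' !inord_val mulrC.
have ci : l.-integrable setT (EFin \o c).
  apply: (bounded_integrable l (M := 1)).
    apply: (@measurable_fun_nat_index _ _ _ _ (io \o fst) (fun n z => dist (a n) (a (io z.2)))) => //.
    by move=> n; exact: (@measurable_fun_nat_index _ _ _ _ (io \o snd) (fun k _ => dist (a n) (a k))).
  by move=> z; rewrite /c ger0_norm ?mdist_ge0.
apply: (@le_trans _ _ (\int[l]_z (D z.1 + c z + D z.2))).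
  have i1 : l.-integrable setT (EFin \o (fun z => D z.1 + c z)).
    exact: integrable_add Dmu.1 ci.
  apply: le_Rintegral => //; first exact: dist_integrable.
    exact: integrable_add i1 Dnu.1.
  move=> [x y] _ /=; rewrite /D /c /=.
  have := metric_triangle x (a (io x)) y.
  have := metric_triangle (a (io x)) (a (io y)) y.
  by rewrite (metric_sym x (a (io x))); lra.
have i1 : l.-integrable setT (EFin \o (fun z => D z.1 + c z)).
  exact: integrable_add Dmu.1 ci.
rewrite (RintegralD _ i1 Dnu.1)// (RintegralD _ Dmu.1 ci)//.
by rewrite /= Dmu.2 Dnu.2 /D; lra.
Qed.

End KantorovichRubinstein.

(** * Discrete random variables on a nonatomic space *)

Section UnitInterval.
Context (R : realType).

(** Lebesgue measure on [[0, 1]] takes every intermediate value, since the mass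
    of [A] to the left of [t] is a 1-Lipschitz function of [t]. *)
Lemma unit_interval_nonatomic : exists P : probability (measurableTypeR R) R,
  forall (A : set (measurableTypeR R)) (v : R), measurable A ->
    0 <= v -> v <= fine (P A) ->
    exists B, [/\ measurable B, B `<=` A & fine (P B) = v].
Proof.
have [P PE] : exists P : probability (measurableTypeR R) R,
    forall A, P A = mrestr (@lebesgue_measure R) (measurable_itv `[0, 1]) A.
  apply: probability_of_measure.
  transitivity (lebesgue_measure (setT `&` `[(0 : R), 1] : set R)); first by [].
  by rewrite setTI lebesgue_measure_itv /= lte01 oppr0 adde0.
have {}PE A : P A = lebesgue_measure (A `&` `[(0:R), 1]) by exact: PE.
exists P => A v mA v0 vA.
pose H (t : R) : set (measurableTypeR R) := A `&` `]-oo, t].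
have mH t : measurable (H t) by apply: measurableI.
pose G (t : R) := fine (P (H t)).
have finP B : measurable B -> P B \is a fin_num by exact: fin_num_measure.
have GB s t : s <= t -> 0 <= G t - G s <= t - s.
  move=> st.
  pose D : set (measurableTypeR R) := A `&` `]s, t].
  have mD : measurable D by apply: measurableI.
  have HD : H t = H s `|` D.
    rewrite /H /D -setIUr; congr (_ `&` _).
    apply/seteqP; split => x /=; rewrite !in_itv/=.
      by case: (leP x s) => xs xt; [left|right].
    by move=> [xs|/andP[_ //]]; exact: le_trans st.
  have -> : G t - G s = fine (P D).
    rewrite /G HD measureU//; first by rewrite fineD ?finP// addrAC subrr add0r.
    apply/seteqP; split => // x [[_ /=]]; rewrite in_itv/= => xs [_ /=].
    by rewrite in_itv/= ltNge xs.
  rewrite fine_ge0//= -lee_fin fineK ?finP// PE.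
  apply: (@le_trans _ _ (lebesgue_measure (`]s, t] : set (measurableTypeR R)))).
    apply: le_measure; rewrite ?inE//; first exact: measurableI.
    by move=> x [[]].
  rewrite lebesgue_measure_itv/=; case: ifP => //= _.
  by rewrite lee_fin subr_ge0.
have Gcont : continuous G.
  move=> t; apply/cvgrPdist_le => e e0; near=> s.
  have ts : `|t - s| <= e by near: s; exact: cvgr_dist_le.
  apply: le_trans ts; have [st|st] := leP s t.
    have /andP[h1 h2] := GB s t st.
    by rewrite !ger0_norm// subr_ge0.
  have /andP[h1 h2] := GB t s (ltW st).
  by rewrite distrC [leRHS]distrC !ger0_norm// subr_ge0 ltW.
(* -1 rather than 0: to the left of it there is no mass at all. *)
have [t _ Gt] : exists2 t, t \in `[-1, 1] & G t = v.
  apply: IVT; [lra|exact: continuous_subspaceT|].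
  have G0 : G (-1) = 0.
    rewrite /G PE (_ : _ `&` _ = set0) ?measure0//.
    apply/seteqP; split => // x [[_ /=]]; rewrite !in_itv/= => x1 /andP[x0 _].
    lra.
  have G1 : G 1 = fine (P A).
    rewrite /G !PE; congr (fine (lebesgue_measure _)).
    rewrite /H -setIA; congr (_ `&` _); apply/seteqP; split => x /=.
      by move=> [].
    by rewrite !in_itv/= => /andP[-> ->].
  by rewrite G0 G1 ge_min v0 /= le_max vA orbT.
by exists (H t); split => // x [].
Unshelve. all: by end_near. Qed.

End UnitInterval.

Section Skeleton.
Context d (T : measurableType d) (R : realType) (P : probability T R).
Hypothesis nonatomic : forall (A : set T) (v : R), measurable A ->
  0 <= v -> v <= fine (P A) ->
  exists B, [/\ measurable B, B `<=` A & fine (P B) = v].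

Lemma nonatomic_split (n : nat) (A : set T) (v : nat -> R) : measurable A ->
  (forall i, 0 <= v i) -> \sum_(i < n.+1) v i = fine (P A) ->
  exists Y : T -> nat, [/\ measurable_fun setT Y, forall x, (Y x <= n)%N &
    forall j, (j <= n)%N -> fine (P (A `&` Y @^-1` [set j])) = v j].
Proof.
have finP B : measurable B -> P B \is a fin_num by exact: fin_num_measure.
elim: n A => [|n ih] A mA v0 vA.
  exists (fun=> 0%N); split => // j; rewrite leqn0 => /eqP ->.
  rewrite big_ord1 in vA; rewrite vA; congr (fine (P _)).
  by apply/seteqP; split => [x []|x Ax].
rewrite big_ord_recr/= in vA.
have vle : v n.+1 <= fine (P A) by rewrite -vA lerDr sumr_ge0.
have [B [mB BA PB]] := nonatomic mA (v0 _) vle.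
have mAB : measurable (A `\` B) by exact: measurableD.
have PAB : \sum_(i < n.+1) v i = fine (P (A `\` B)).
  have : fine (P A) = fine (P B) + fine (P (A `\` B)).
    rewrite -fineD ?finP// -measureU//; first by rewrite setDUK.
    by rewrite setDIK.
  by rewrite -vA PB; lra.
have [Y [mY Yn YE]] := ih _ mAB v0 PAB.
have mBb : measurable_fun setT (fun x => x \in B).
  apply: (measurable_fun_bool true); rewrite setTI (_ : _ @^-1` _ = B)//.
  by apply/seteqP; split=> x /=; [move/set_mem|move/mem_set].
exists (fun x => if x \in B then n.+1 else Y x); split.
- exact: measurable_fun_ifT.
- by move=> x; case: ifP => // _; exact: leqW.
- move=> j; rewrite leq_eqVlt => /predU1P[->|jn].
    rewrite -PB; congr (fine (P _)); apply/seteqP; split => x.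
      move=> [Ax /=]; case: ifP => [/set_mem//|_ Yx].
      by have := Yn x; rewrite Yx ltnn.
    by move=> Bx; split => /=; [exact: BA|rewrite mem_set].
  rewrite ltnS in jn; rewrite -YE//; congr (fine (P _)); apply/seteqP; split => x.
    move=> [Ax /=]; case: ifP => [_ nj|/negP xB Yx].
      by move: jn; rewrite -nj ltnn.
    by split => //; split => //; move/mem_set.
  by move=> [[Ax /= xB] Yx]; split => //=; rewrite memNset.
Qed.

Variables (n : nat -> nat) (w : nat -> nat -> R) (p : nat -> nat -> nat -> R).
Hypothesis n_mono : forall k, (n k <= n k.+1)%N.
Hypothesis w_supp : forall k i, (n k < i)%N -> w k i = 0.
Hypothesis w0_ge0 : forall i, 0 <= w 0 i.
Hypothesis w0_sum : \sum_(i < (n 0).+1) w 0 i = 1.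
Hypothesis p_ge0 : forall k i j, 0 <= p k i j.
Hypothesis p_row : forall k i, (i <= n k.+1)%N ->
  \sum_(j < (n k.+1).+1) p k i j = w k i.
Hypothesis p_col : forall k j, (j <= n k.+1)%N ->
  \sum_(i < (n k.+1).+1) p k i j = w k.+1 j.

Let law k (X : T -> nat) := [/\ measurable_fun setT X, forall x, (X x <= n k)%N &
  forall i, (i <= n k)%N -> fine (P (X @^-1` [set i])) = w k i].

Let joint k (X X' : T -> nat) := forall i j, (i <= n k.+1)%N -> (j <= n k.+1)%N ->
  fine (P (X @^-1` [set i] `&` X' @^-1` [set j])) = p k i j.

Let skeleton0 : exists X, law 0 X.
Proof.
have [Y [mY Yn YE]] := @nonatomic_split (n 0%N) setT (w 0) measurableT w0_ge0
  ltac:(by rewrite w0_sum probability_setT).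
by exists Y; split => // i i0; rewrite -YE// setTI.
Qed.

Let skeletonS k X : law k X -> exists X', law k.+1 X' /\ joint k X X'.
Proof.
move=> [mX Xn XE].
have mXi i : measurable (X @^-1` [set i]).
  by rewrite -[X in measurable X]setTI; exact: mX.
have XE' i : (i <= n k.+1)%N -> \sum_(j < (n k.+1).+1) p k i j = fine (P (X @^-1` [set i])).
  move=> ik; rewrite p_row//; have [ni|ni] := leqP i (n k); first by rewrite XE.
  rewrite w_supp// (_ : _ @^-1` _ = set0) ?measure0//.
  by apply/seteqP; split => // x /= Xi; have := Xn x; rewrite Xi leqNgt ni.
have /choice[Y YE] i : exists Y : T -> nat, (i <= n k.+1)%N ->
    [/\ measurable_fun setT Y, forall x, (Y x <= n k.+1)%N &
    forall j, (j <= n k.+1)%N ->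
      fine (P (X @^-1` [set i] `&` Y @^-1` [set j])) = p k i j].
  have [ik|ik] := leqP i (n k.+1); last by exists (fun=> 0%N).
  by have [Y HY] := nonatomic_split (mXi i) (p_ge0 k i) (XE' i ik); exists Y.
have Xn' x : (X x <= n k.+1)%N by exact: leq_trans (Xn x) (n_mono k).
pose Z i := if (i <= n k.+1)%N then Y i else (fun=> 0%N).
have mZ i : measurable_fun setT (Z i).
  by rewrite /Z; case: ifP => // ik; have [] := YE i ik.
pose X' x := Z (X x) x.
have mX' : measurable_fun setT X' by exact: (measurable_fun_nat_index mX mZ).
have jX : joint k X X'.
  move=> i j ik jk; have [_ _ <-//] := YE i ik.
  congr (fine (P _)); apply/seteqP; split => x [/= Xi].
    by rewrite /X' /Z Xi ik.
  by move=> Yj; rewrite /X' /Z Xi ik.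
exists X'; split => //; split => // [x|j jk].
  by rewrite /X' /Z Xn'; have [_ + _] := YE _ (Xn' x); apply.
have mX'j : measurable (X' @^-1` [set j]).
  by rewrite -[X in measurable X]setTI; exact: mX'.
rewrite (measure_cells P (n := (n k.+1).+1) mX)//.
rewrite -p_col// -[RHS]/(fine (_)%:E) -sumEFin; congr fine.
apply: eq_bigr => i _; rewrite -[LHS]fineK; last first.
  by apply: fin_num_measure; exact: measurableI.
by rewrite setIC jX// -ltnS.
Qed.

(** Given a chain of finite plans, random variables realizing all of them on one
    space are built one after the other: [X k.+1] splits each event
    [X k = i] in the proportions of the [i]-th row of the plan [p k]. *)
Lemma skeleton : exists X : nat -> T -> nat, forall k, law k (X k) /\ joint k (X k) (X k.+1).
Proof.
have [X0 l0] := skeleton0.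
pose S k := {X | law k X}.
pose nxt k (s : S k) : S k.+1 :=
  let e := cid (skeletonS (proj2_sig s)) in
  exist _ (proj1_sig e) (proj1 (proj2_sig e)).
pose fix f k : S k := if k is k'.+1 then nxt k' (f k') else exist _ X0 l0.
exists (fun k => proj1_sig (f k)) => k; split; first exact: (proj2_sig (f k)).
exact: (proj2 (proj2_sig (cid (skeletonS (proj2_sig (f k)))))).
Qed.

End Skeleton.

(** * Limits of random variables with summable steps *)

Section RandomLimit.
Context (R : realType) (E : completeMetricType R).
Notation dist x y := (@mdist R E x y).
Hypothesis dist_le1 : forall x y : E, dist x y <= 1.

Lemma summable_steps_cvg (u : nat -> E) (M : R) :
  (forall n, \sum_(0 <= k < n) dist (u k) (u k.+1) <= M) -> cvgn u.
Proof.
move=> uM; pose S n := \sum_(0 <= k < n) dist (u k) (u k.+1).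
have distS n m : (n <= m)%N -> dist (u n) (u m) <= S m - S n.
  elim: m => [|m ih]; first by rewrite leqn0 => /eqP ->; rewrite mdistxx subrr.
  rewrite leq_eqVlt => /predU1P[->|]; first by rewrite mdistxx subrr.
  rewrite ltnS => nm.
  have -> : S m.+1 = S m + dist (u m) (u m.+1) by rewrite /S big_nat_recr.
  by have := ih nm; have := metric_triangle (u n) (u m) (u m.+1); lra.
have ndS : nondecreasing_seq S.
  move=> n m nm; rewrite -subr_ge0; apply: le_trans (distS n m nm).
  exact: mdist_ge0.
have cS : cvgn S.
  apply: nondecreasing_is_cvgn => //; exists M => _ [n _ <-]; exact: uM.
apply: cauchy_cvg; apply: cauchy_exP => e e0.
have /cvgrPdist_lt /(_ (e / 2)) := cS; case; first by rewrite divr_gt0.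
move=> n _ hn; exists (u n); exists n => // m /= nm.
rewrite ballEmdist/=; apply: le_lt_trans (distS n m nm) _.
have := hn n (leqnn n); have := hn m nm; rewrite /= !ltr_norml.
by move=> /andP[h1 h2] /andP[h3 h4]; lra.
Qed.

Hypothesis hsep : separable E.

(** An open set is the union of the balls it contains whose centre is in a dense
    sequence and whose radius is [m.+1%:R^-1]; these are countably many. *)
Lemma measurable_of_dist d (T : measurableType d) (Y : T -> borel E) :
  (forall b : E, measurable_fun setT (fun t => dist b (Y t))) ->
  measurable_fun setT Y.
Proof.
move=> mY; have [a ha] := dense_sequence hsep.
apply: (@measurability _ _ T (borel E) setT Y (@open E)) => //.
move=> _ [U oU <-]; rewrite setTI.
pose r (m : nat) : R := m.+1%:R^-1.
have r0 m : 0 < r m by rewrite invr_gt0.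
have -> : Y @^-1` U = \bigcup_n \bigcup_m
    (if `[< ball (a n) (r m) `<=` U >] then [set t | dist (a n) (Y t) < r m] else set0).
  apply/seteqP; split => t /=.
    move=> Ut; have : nbhs (Y t : E) U by exact: open_nbhs_nbhs.
    move=> /nbhs_ballP[e /= e0 eU].
    have [m rm] : exists m, 2 * r m < e.
      have e2 : 0 < e / 2 by lra.
      have /cvgrPdist_lt/(_ _ e2)[m _ hm] := @cvg_harmonic R.
      exists m; have := hm m (leqnn m).
      rewrite /= sub0r normrN ger0_norm ?invr_ge0//= -/(r m) => h.
      lra.
    have [n an] := ha (Y t) _ (r0 m).
    exists n => //; exists m => //; rewrite asboolT//.
    move=> x; rewrite ballEmdist/= => anx; apply: eU; rewrite ballEmdist/=.
    apply: le_lt_trans (metric_triangle (Y t : E) (a n) x) _.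
    by rewrite (metric_sym (Y t : E)); apply: lt_trans rm; rewrite mulr2n mulrDl mul1r ltrD.
  move=> [n _ [m _]]; case: asboolP => // sU /= h; apply: sU.
  by rewrite ballEmdist.
apply: bigcupT_measurable => n; apply: bigcupT_measurable => m.
case: asboolP => // _; rewrite -[X in measurable X]setTI.
rewrite (_ : [set t | _] = (fun t => dist (a n) (Y t)) @^-1` `]-oo, r m[).
  exact: mY.
by apply/seteqP; split => t /=; rewrite in_itv.
Qed.

Context d (T : measurableType d) (P : probability T R).

(** The total length of the steps has finite mean, hence is finite almost surely,
    and completeness of the space gives a limit there. *)
Lemma random_limit (a : nat -> E) (X : nat -> T -> nat) (C : R) :
  (forall k, measurable_fun setT (X k)) ->
  (forall k, \int[P]_t dist (a (X k t)) (a (X k.+1 t)) <= C * (2^-1) ^+ k) ->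
  exists Y : T -> borel E, measurable_fun setT Y /\
    forall f, lipschitz1 f ->
      \int[P]_t f (a (X k t)) @[k --> \oo] --> \int[P]_t f (Y t).
Proof.
move=> mX XC.
have mg (g : nat -> R) k : measurable_fun setT (fun t => g (X k t)).
  exact: (@measurable_fun_nat_index _ _ _ _ (X k) (fun n _ => g n)).
pose D k t := dist (a (X k t)) (a (X k.+1 t)).
have mD k : measurable_fun setT (D k).
  apply: (@measurable_fun_nat_index _ _ _ _ (X k) (fun n t => dist (a n) (a (X k.+1 t)))) => //.
  by move=> n; apply: (mg (fun i => dist (a n) (a i))).
have D0 k t : 0 <= D k t by exact: mdist_ge0.
have Di k : P.-integrable setT (EFin \o D k).
  by apply: (bounded_integrable P (mD k) (M := 1)) => t; rewrite ger0_norm//; exact: dist_le1.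
pose Z t := (\sum_(k <oo) (D k t)%:E)%E.
have mZ : measurable_fun setT Z.
  apply: ge0_emeasurable_sum => [k t _ _|k _]; first by rewrite lee_fin.
  exact/measurable_EFinP.
have Z0 t : (0 <= Z t)%E by apply: nneseries_ge0 => k _ _; rewrite lee_fin.
have C0 : 0 <= C.
  have := XC 0%N; rewrite expr0 mulr1; apply: le_trans.
  by apply: Rintegral_ge0 => t _; exact: D0.
have Zi : P.-integrable setT Z.
  apply/integrableP; split => //.
  under eq_integral do rewrite gee0_abs//.
  rewrite integral_nneseries//; last 2 first.
  - by move=> k; exact/measurable_EFinP.
  - by move=> k t _; rewrite lee_fin.
  apply: (@le_lt_trans _ _ (\sum_(k <oo) (C * (2^-1) ^+ k)%:E)%E).
    apply: lee_nneseries => [k _ _|k _]; first by apply: integral_ge0 => t _; rewrite lee_fin.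
    have fk : (\int[P]_t (D k t)%:E)%E \is a fin_num := integrable_fin_num measurableT (Di k).
    by rewrite -(fineK fk) lee_fin; exact: XC.
  have geo : series (geometric C 2^-1) @ \oo --> C * (1 - 2^-1)^-1.
    by apply: cvg_geometric_series; rewrite ger0_norm ?invr_ge0// invf_lt1// ltr1n.
  rewrite (_ : (\sum_(k <oo) _)%E = (C * (1 - 2^-1)^-1)%:E) ?ltry//.
  apply/cvg_lim => //; rewrite (_ : (fun n => _) = EFin \o series (geometric C 2^-1)).
    by apply: cvg_EFin; [exact: nearW|exact: geo].
  by apply/funext => n; rewrite sumEFin.
pose G := [set t | (Z t < +oo)%E].
have mG : measurable G.
  rewrite -[X in measurable X]setTI.
  exact: emeasurable_fun_infty_o.
have PG : {ae P, forall t, G t}.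
  have := integrable_ae measurableT Zi; apply: filterS => t /(_ I).
  by rewrite ge0_fin_numE.
(* Constant on the null set where the steps may not be summable, so that the
   limit exists everywhere. *)
pose X' k t := if t \in G then X k t else 0%N.
have mX' k : measurable_fun setT (X' k).
  apply: measurable_fun_ifT => //.
  apply: (measurable_fun_bool true); rewrite setTI (_ : _ @^-1` _ = G)//.
  by apply/seteqP; split=> t /=; [move/set_mem|move/mem_set].
have mg' (g : nat -> R) k : measurable_fun setT (fun t => g (X' k t)).
  exact: (@measurable_fun_nat_index _ _ _ _ (X' k) (fun n _ => g n)).
have cvgX' t : cvgn (fun k => a (X' k t)).
  rewrite /X'; have [tG|_] := boolP (t \in G); last exact: is_cvg_cst.
  have Gt := set_mem tG.
  apply: (@summable_steps_cvg _ (fine (Z t))) => n.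
  rewrite -lee_fin fineK ?ge0_fin_numE// -sumEFin.
  apply: (@nneseries_lim_ge _ (fun k => (D k t)%:E) xpredT 0%N n) => k _ _.
  by rewrite lee_fin.
pose Y t : borel E := lim (a (X' k t) @[k --> \oo]).
have cvgY f t : lipschitz1 f -> f (a (X' k t)) @[k --> \oo] --> f (Y t).
  move=> lf; apply/cvgrPdist_lt => e e0.
  have /metricType_numDomainType.cvgrPdist_lt /(_ _ e0) := cvgX' t.
  apply: filterS => k h; apply: le_lt_trans h.
  rewrite ler_norml; apply/andP; split; last exact: lf.
  by rewrite lerNl opprB metric_sym; exact: lf.
have mfY f : lipschitz1 f -> measurable_fun setT (fun t => f (Y t)).
  move=> lf; apply: (@measurable_fun_cvg _ _ R setT (fun k t => f (a (X' k t)))).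
    by move=> k; exact: (mg' (fun i => f (a i))).
  by move=> t _; exact: cvgY.
exists Y; split.
  by apply: measurable_of_dist => b; apply: mfY; exact: lipschitz1_dist.
move=> f lf.
have -> : (fun k => \int[P]_t f (a (X k t))) = (fun k => \int[P]_t f (a (X' k t))).
  apply/funext => k; rewrite /Rintegral; congr fine; apply: ae_eq_integral => //.
  - exact/measurable_EFinP/(mg (fun i => f (a i))).
  - exact/measurable_EFinP/(mg' (fun i => f (a i))).
  - by apply: filterS PG => t Gt _; rewrite /X' mem_set.
apply: (@mean_cvg _ _ _ P (fun k t => f (a (X' k t))) _ (`|f point| + 1)).
- by move=> k; exact: (mg' (fun i => f (a i))).
- exact: mfY.
- by move=> k t; exact: lipschitz1_bounded.
- by move=> t; exact: cvgY.
Qed.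

End RandomLimit.

(** * Completeness of the space of laws *)

Section Completeness.
Context (R : realType) (E : completeMetricType R).
Notation dist x y := (@mdist R E x y).
Hypothesis hsep : separable E.
Hypothesis dist_le1 : forall x y : E, dist x y <= 1.

(** The Wasserstein distance is complete.  Along a fast subsequence the laws are
    quantized more and more finely; duality on the centres gives plans between
    consecutive discrete laws of geometrically decreasing cost; [skeleton]
    realizes them by random variables on the unit interval, and their almost sure
    limit has the required law.  This avoids any compactness of families of
    measures. *)
Lemma lipschitz1_limit_measure (mu : nat -> probability (borel E) R)
    (L : (E -> R) -> R) (e : nat -> R) : e @ \oo --> 0 ->
  (forall f, lipschitz1 f -> forall k, `|\int[mu k]_x f x - L f| <= e k) ->
  exists pi : probability (borel E) R,
    forall f, lipschitz1 f -> \int[pi]_x f x = L f.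
Proof.
move=> e0 muL.
pose q k : R := (2^-1) ^+ k.
have q0 k : 0 < q k by rewrite exprn_gt0// invr_gt0.
have qS k : q k.+1 <= q k by rewrite /q exprS ler_piMl ?(ltW (q0 k))// invf_le1// ler1n.
have /choice[s sE] k : exists s, e s <= q k.
  have /cvgrPdist_lt/(_ _ (q0 k))[s _ hs] := e0; exists s.
  have := hs s (leqnn s); rewrite /= sub0r normrN => h.
  by apply: ltW; apply: le_lt_trans h; exact: ler_norm.
have [a ha] := dense_sequence hsep.
have /choice[N0 N0E] k := quantization dist_le1 ha (mu (s k)) (q0 k).
pose n k := (\sum_(j < k.+1) N0 j)%N.
have nS k : (n k <= n k.+1)%N by rewrite /n [leqRHS]big_ord_recr leq_addr.
have N0n k : (N0 k <= n k)%N by rewrite /n big_ord_recr leq_addl.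
pose io k := center a (q k) (n k).
have mio k : measurable_fun setT (io k) by exact: center_measurable.
have ion k x : (io k x <= n k)%N by exact: center_le.
have ioq k : \int[mu (s k)]_x dist (a (io k x)) x <= 2 * q k by exact: N0E.
pose w k i := fine (mu (s k) (io k @^-1` [set i])).
have wE k m (g : nat -> R) : (n k <= m)%N ->
    \int[mu (s k)]_x g (io k x) = \sum_(i < m.+1) g i * w k i.
  move=> nm; apply: mean_nat_index => // x; rewrite ltnS; exact: leq_trans (ion k x) nm.
have wL k f : lipschitz1 f -> `|\int[mu (s k)]_x f (a (io k x)) - L f| <= 3 * q k.
  move=> lf; have fi := lipschitz1_integrable dist_le1 (mu (s k)) lf.
  have fa : (mu (s k)).-integrable setT (EFin \o (fun x => f (a (io k x)))).
    apply: (bounded_integrable _ (M := `|f point| + 1)).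
      exact: (@measurable_fun_nat_index _ _ _ _ (io k) (fun n _ => f (a n))).
    by move=> x; exact: lipschitz1_bounded.
  have h1 : `|\int[mu (s k)]_x f (a (io k x)) - \int[mu (s k)]_x f x| <= 2 * q k.
    rewrite -(RintegralB _ fa fi)//; have di := integrable_sub fa fi.
    apply: le_trans (le_normr_Rintegral _ di) _ => //.
    apply: le_trans (ioq k); apply: le_Rintegral => //.
    - by have := integrable_norm di.
    - exact: center_dist_integrable.
    - move=> x _; rewrite ler_norml; apply/andP; split; last exact: lf.
      by rewrite lerNl opprB metric_sym; exact: lf.
  have h2 := le_trans (muL f lf (s k)) (sE k).
  rewrite -(subrKA (\int[mu (s k)]_x f x)).
  by apply: le_trans (ler_normD _ _) _; lra.
have plan k : exists p : nat -> nat -> R, [/\ forall i j, 0 <= p i j,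
    forall i, (i <= n k.+1)%N -> \sum_(j < (n k.+1).+1) p i j = w k i,
    forall j, (j <= n k.+1)%N -> \sum_(i < (n k.+1).+1) p i j = w k.+1 j &
    \sum_(i < (n k.+1).+1) \sum_(j < (n k.+1).+1) dist (a i) (a j) * p i j <= 6 * q k].
  pose I := 'I_(n k.+1).+1.
  have w0 k' (i : I) : 0 <= w k' i by exact: fine_ge0.
  have w1 k' : (n k' <= n k.+1)%N -> \sum_(i : I) w k' i = 1.
    move=> kk; have := wE k' (n k.+1) (fun=> 1) kk; rewrite mean_cst => ->.
    by apply: eq_bigr => i _; rewrite mul1r.
  have hu (u : I -> R) : (forall i j : I, u i - u j <= dist (a i) (a j)) ->
      \sum_(i : I) w k i * u i - \sum_(i : I) w k.+1 i * u i <= 6 * q k.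
    move=> lu; have [f lf fu] := mcshane lu.
    have fE (i : I) : u i = f (a i).
      by apply/esym/eqP; have := fu i (a i); rewrite mdistxx normr_le0 subr_eq0.
    have gE k' : (n k' <= n k.+1)%N ->
        \sum_(i : I) w k' i * u i = \int[mu (s k')]_x f (a (io k' x)).
      move=> kk; rewrite (wE k' (n k.+1) (fun i => f (a i)) kk).
      by apply: eq_bigr => i _; rewrite fE mulrC.
    rewrite !gE//; have := wL k f lf; have := wL k.+1 f lf; rewrite !ler_norml.
    by move=> /andP[h1 h2] /andP[h3 h4]; have := qS k; lra.
  have [P [P0 Prow Pcol Pcost]] := finite_kantorovich_rubinstein (w0 k) (w0 k.+1)
    (w1 k (nS k)) (w1 k.+1 (leqnn _))
    (fun i => mdistxx (a i)) (fun i j l => metric_triangle (a i) (a j) (a l)) hu.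
  exists (fun i j => P (inord i) (inord j)); split => [//|i ik|j jk|].
  - rewrite -[in RHS](inordK (n' := n k.+1) (m := i))// -Prow.
    by apply: eq_bigr => j _; rewrite inord_val.
  - rewrite -[in RHS](inordK (n' := n k.+1) (m := j))// -Pcol.
    by apply: eq_bigr => i _; rewrite inord_val.
  - apply: le_trans Pcost; apply: ler_sum => i _; apply: ler_sum => j _.
    by rewrite !inord_val mulrC.
have {plan} /choice[p pE] := plan.
have [U Uat] := unit_interval_nonatomic R.
have ws k i : (n k < i)%N -> w k i = 0.
  move=> ki; rewrite /w (_ : _ @^-1` _ = set0) ?measure0//.
  by apply/seteqP; split => // x /= xi; have := ion k x; rewrite xi leqNgt ki.
have w0 i : 0 <= w 0%N i by exact: fine_ge0.
have w01 : \sum_(i < (n 0%N).+1) w 0%N i = 1.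
  have := wE 0%N (n 0%N) (fun=> 1) (leqnn _); rewrite mean_cst => ->.
  by apply: eq_bigr => i _; rewrite mul1r.
have p0 k i j : 0 <= p k i j by have [+ _ _ _] := pE k; apply.
have prow k i : (i <= n k.+1)%N -> \sum_(j < (n k.+1).+1) p k i j = w k i.
  by have [_ + _ _] := pE k; apply.
have pcol k j : (j <= n k.+1)%N -> \sum_(i < (n k.+1).+1) p k i j = w k.+1 j.
  by have [_ _ + _] := pE k; apply.
have [X XE] := skeleton Uat nS ws w0 w01 p0 prow pcol.
have mX k : measurable_fun setT (X k) by have [[]] := XE k.
have Xn k t : (X k t <= n k)%N by have [[_ + _] _] := XE k; apply.
have Xw k i : (i <= n k)%N -> fine (U (X k @^-1` [set i])) = w k i.
  by have [[_ _ +] _] := XE k; apply.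
have XC k : \int[U]_t dist (a (X k t)) (a (X k.+1 t)) <= 6 * 2^-1 ^+ k.
  rewrite (mean_nat_index2 U (n := (n k.+1).+1) (fun i j => dist (a i) (a j)) (mX k) (mX k.+1)).
  - have [_ _ _] := pE k; apply: le_trans.
    apply: ler_sum => i _; apply: ler_sum => j _.
    by have [_ ->] := XE k; rewrite // -ltnS.
  - by move=> t; rewrite ltnS; exact: leq_trans (Xn k t) (nS k).
  - by move=> t; rewrite ltnS; exact: Xn.
have [Y [mY Ycvg]] := random_limit dist_le1 hsep mX XC.
pose Ym : {mfun measurableTypeR R >-> borel E} := mfun_Sub (mem_set mY).
exists (distribution U Ym) => f lf.
have fi := lipschitz1_integrable dist_le1 (distribution U Ym) lf.
have [_ <-] := mean_image (l := U) (m := distribution U Ym) (p := Y) mY (fun A mA => erefl) fi.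
have aX k : \int[U]_t f (a (X k t)) = \int[mu (s k)]_x f (a (io k x)).
  rewrite (wE k (n k) (fun i => f (a i)) (leqnn _)).
  rewrite (mean_nat_index U (n := (n k).+1) (fun i => f (a i)) (mX k)).
    by apply: eq_bigr => i _; rewrite Xw// -ltnS.
  by move=> t; rewrite ltnS; exact: Xn.
apply: (@cvg_unique _ (@Rhausdorff R) (\int[U]_t f (a (X k t)) @[k --> \oo]) _).
  exact: Ycvg.
apply/cvgrPdist_le => eps eps0.
have qcvg : q @ \oo --> (0 : R).
  by apply: cvg_expr; rewrite ger0_norm ?invr_ge0// invf_lt1// ltr1n.
have eps3 : 0 < eps / 3 by rewrite divr_gt0.
have /cvgrPdist_le/(_ _ eps3) := qcvg; apply: filterS => k.
rewrite sub0r normrN ger0_norm ?(ltW (q0 k))// => h.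
by rewrite aX distrC; apply: le_trans (wL k f lf) _; lra.
Qed.

End Completeness.

(** * Composition of kernels *)

Section KernelMeans.
Context d (T : measurableType d) (R : realType).
Variable P : T -> probability T R.
Hypothesis mP : forall A, measurable A -> measurable_fun setT (P ^~ A).

Let Pg (x : T) : giry T R := P x.

Let mPg : measurable_fun setT Pg.
Proof. exact: measurable_giry_codensity. Qed.

Lemma measurable_kernel_integral (f : T -> \bar R) :
  measurable_fun setT f -> (forall x, 0 <= f x)%E ->
  measurable_fun setT (fun x => \int[P x]_t f t)%E.
Proof.
move=> mf f0.
exact: (measurableT_comp (measurable_giry_int mf f0) mPg).
Qed.

Section Composition.
Variables (m m' : probability T R).
Hypothesis mE : forall A, measurable A -> m' A = (\int[m]_t P t A)%E.

Lemma kernel_integral (f : T -> \bar R) :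
  measurable_fun setT f -> (forall x, 0 <= f x)%E ->
  (\int[m']_t f t = \int[m]_t \int[P t]_u f u)%E.
Proof.
move=> mf f0.
have -> : (\int[m']_t f t = \int[giry_bind (m : giry T R) mPg]_t f t)%E.
  apply: eq_measure_integral => A mA _; apply: etrans (mE mA) _.
  by have /esym := giry_int_map mPg (m : giry T R) (measurable_giry_ev mA)
    (fun=> measure_ge0 _ _).
exact: (giry_int_bind (m : giry T R) mPg mf f0).
Qed.

(** Adding [M] reduces bounded functions to nonnegative ones. *)
Lemma kernel_mean (f : T -> R) (M : R) : measurable_fun setT f ->
  (forall x, `|f x| <= M) ->
  measurable_fun setT (fun x => \int[P x]_t f t) /\
  \int[m']_t f t = \int[m]_t \int[P t]_u f u.
Proof.
move=> mf fM.
have fi (l : probability T R) : l.-integrable setT (EFin \o f).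
  exact: bounded_integrable fM.
pose g t := f t + M.
have gi (l : probability T R) : l.-integrable setT (EFin \o g).
  by apply: integrable_add => //; exact: cst_integrable.
have g0 t : (0 <= (g t)%:E)%E.
  by rewrite lee_fin /g; have := fM t; rewrite ler_norml => /andP[+ _]; lra.
have mg : measurable_fun setT (EFin \o g).
  by apply/measurable_EFinP; exact: measurable_funD.
have gE (l : probability T R) : (\int[l]_t (g t)%:E = (\int[l]_t f t + M)%:E)%E.
  have := RintegralD measurableT (fi l) (cst_integrable l M).
  rewrite mean_cst => <-; rewrite /Rintegral fineK//.
  exact: (integrable_fin_num measurableT (gi l)).
have mPf : measurable_fun setT (fun x => \int[P x]_t f t).
  have := measurable_kernel_integral mg g0.
  under eq_fun do rewrite gE.
  move/measurable_EFinP => h.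
  have -> : (fun x => \int[P x]_t f t) =
      (fun x => \int[P x]_t f t + M) \- (fun=> M).
    by apply/funext => x /=; rewrite addrK.
  exact: (measurable_funB h (measurable_cst M)).
split => //.
have PfM x : `|\int[P x]_t f t| <= M.
  apply: le_trans (le_normr_Rintegral _ (fi _)) _ => //.
  rewrite -[leRHS](mean_cst (P x)); apply: le_Rintegral => //.
    by have := integrable_norm (fi (P x)).
  exact: cst_integrable.
have Pfi : m.-integrable setT (EFin \o (fun x => \int[P x]_t f t)).
  exact: bounded_integrable PfM.
have := kernel_integral mg g0; rewrite /= gE.
under eq_integral do rewrite gE.
have -> : (\int[m]_x (\int[P x]_t f t + M)%:E = (\int[m]_x \int[P x]_t f t + M)%:E)%E.
  have := RintegralD measurableT Pfi (cst_integrable m M).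
  rewrite mean_cst => <-; rewrite /Rintegral fineK//.
  exact: (integrable_fin_num measurableT (integrable_add Pfi (cst_integrable m M))).
by case=> /addIr.
Qed.

End Composition.

Lemma kernel_bind (m : probability T R) : exists m' : probability T R,
  forall A, measurable A -> m' A = (\int[m]_t P t A)%E.
Proof.
have bE A : measurable A -> giry_bind (m : giry T R) mPg A = (\int[m]_t P t A)%E.
  move=> mA.
  exact: (giry_int_map mPg (m : giry T R) (measurable_giry_ev mA) (fun=> measure_ge0 _ _)).
have b1 : giry_bind (m : giry T R) mPg setT = 1%E.
  rewrite bE//; under eq_integral do rewrite probability_setT.
  by rewrite integral_cst//= probability_setT mul1e.
have [m' m'E] := probability_of_measure b1.
by exists m' => A mA; rewrite m'E; exact: bE.
Qed.

End KernelMeans.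

(** * Contraction of a weighted distance *)

Section WeightedMeans.
Context (R : realType).

Lemma powR_amgm (al x y : R) : 0 < al -> al < 1 -> 0 <= x -> 0 <= y ->
  x `^ al * y `^ (1 - al) <= al * x + (1 - al) * y.
Proof.
move=> al0 al1 x0 y0; have al1' : 0 < 1 - al by lra.
have i1 : al^-1^-1 + (1 - al)^-1^-1 = 1 by rewrite !invrK; lra.
have := conjugate_powR (powR_ge0 x al) (powR_ge0 y (1 - al)) _ _ i1.
rewrite !invr_gt0 -!powRrM !divff ?gt_eqF// !powRr1// !invrK => /(_ al0 al1').
lra.
Qed.

(** The supporting plane of the concave function [u `^ al * v `^ (1 - al)] at
    [(a, b)]. *)
Lemma powR_amgm_at (al a b x y : R) : 0 < al -> al < 1 -> 0 < a -> 0 < b ->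
  0 <= x -> 0 <= y ->
  x `^ al * y `^ (1 - al) <=
    a `^ al * b `^ (1 - al) * (al * (x / a) + (1 - al) * (y / b)).
Proof.
move=> al0 al1 a0 b0 x0 y0.
have xa : 0 <= x / a by rewrite divr_ge0// ltW.
have yb : 0 <= y / b by rewrite divr_ge0// ltW.
have -> : x `^ al * y `^ (1 - al) =
    a `^ al * b `^ (1 - al) * ((x / a) `^ al * (y / b) `^ (1 - al)).
  rewrite mulrACA -!powRM ?(ltW a0) ?(ltW b0)//.
  by rewrite ![_ * (_ / _)]mulrC !divfK ?gt_eqF.
by rewrite ler_wpM2l ?mulr_ge0 ?powR_ge0// powR_amgm.
Qed.

End WeightedMeans.

Section Contraction.
Context (R : realType) (E : completeMetricType R).
Notation dist x y := (@mdist R E x y).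
Hypothesis hsep : separable E.
Hypothesis dist_le1 : forall x y : E, dist x y <= 1.
Variables (P : borel E -> probability (borel E) R) (V : borel E -> R).
Hypothesis V_ge0 : forall x, 0 <= V x.
Hypothesis V_integrable : forall x, (P x).-integrable setT (EFin \o V).
Hypothesis W_le_dist : forall x y : E,
  (wasserstein (P x) (P y) <= (dist x y)%:E)%E.

Definition pop (f : E -> R) (x : E) : R := \int[P x]_t f t.

(** An affine bound of [f u - f v] in the distance and in [V u + V v] can be
    integrated against a nearly optimal coupling: of the last term only the
    marginals matter. *)
Lemma pop_sub_le (f : E -> R) (x y : E) (c0 c1 c2 w : R) : lipschitz1 f ->
  0 <= c1 -> (forall u v, f u - f v <= c0 + c1 * dist u v + c2 * (V u + V v)) ->
  (wasserstein (P x) (P y) <= w%:E)%E ->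
  pop f x - pop f y <= c0 + c1 * w + c2 * (pop V x + pop V y).
Proof.
move=> lf c10 fle W.
suff H e : 0 < e -> pop f x - pop f y <=
    c0 + c1 * (w + e) + c2 * (pop V x + pop V y).
  apply/ler_addgt0Pr => e e0.
  have e' : 0 < e / (c1 + 1) by rewrite divr_gt0//; lra.
  apply: (le_trans (H _ e')); rewrite mulrDr.
  have : c1 * (e / (c1 + 1)) <= e.
    by rewrite mulrA ler_pdivrMr; [nra|lra].
  lra.
move=> e0; have [l cl hl] := wasserstein_coupling hsep dist_le1 W e0.
have fi m := lipschitz1_integrable dist_le1 m lf.
have [f1 f1E] := mean_fst cl (fi _).
have [f2 f2E] := mean_snd cl (fi _).
have [V1 V1E] := mean_fst cl (V_integrable x).
have [V2 V2E] := mean_snd cl (V_integrable y).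
have di := dist_integrable hsep dist_le1 l.
have VVi := integrable_add V1 V2.
have cVi := integrable_scale c2 VVi.
have cdi := integrable_scale c1 di.
have i1 := integrable_add (cst_integrable l c0) cdi.
have := le_Rintegral measurableT (integrable_sub f1 f2) (integrable_add i1 cVi)
  (fun z _ => fle z.1 z.2).
rewrite (RintegralB measurableT f1 f2) (RintegralD measurableT i1 cVi).
rewrite (RintegralD measurableT (cst_integrable l c0) cdi) mean_cst.
rewrite (RintegralZl c1 measurableT di) (RintegralZl c2 measurableT VVi).
rewrite (RintegralD measurableT V1 V2) /= f1E f2E V1E V2E -/(pop f x) -/(pop f y).
move=> h; apply: (le_trans h).
by rewrite /pop !lerD2r lerD2l ler_wpM2l.
Qed.

Lemma pop_lipschitz1 f : lipschitz1 f -> lipschitz1 (pop f).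
Proof.
move=> lf x y.
have := @pop_sub_le f x y 0 1 0 (dist x y) lf ler01 _ (W_le_dist x y).
rewrite !mul0r !add0r !addr0 mul1r; apply => u v.
by rewrite !mul0r add0r addr0 mul1r.
Qed.

Lemma iter_pop_lipschitz1 n f : lipschitz1 f -> lipschitz1 (iter n pop f).
Proof. by move=> lf; elim: n => //= n ih; exact: pop_lipschitz1. Qed.

(** Jensen and Hoelder in one step, by integrating the supporting plane of the
    jointly concave bound at the point [(a, s)] against a near-optimal
    coupling. *)
Lemma pop_sub_le_concave (f : E -> R) (x y : E) (al G a s : R) (q : R -> R) :
  0 < al -> al < 1 -> lipschitz1 f -> 0 <= G ->
  (forall u v, f u - f v <= G * (dist u v `^ al * q (V u + V v) `^ (1 - al))) ->
  (forall t, 0 <= t -> 0 <= q t) -> 0 < q s ->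
  (exists2 p, 0 <= p & forall t, 0 <= t -> q t <= q s + p * (t - s)) ->
  0 < a -> (wasserstein (P x) (P y) <= a%:E)%E -> pop V x + pop V y <= s ->
  pop f x - pop f y <= G * (a `^ al * q s `^ (1 - al)).
Proof.
move=> al0 al1 lf G0 fle q0 qs0 [p p0 hp] a0 W hs.
set b := q s in qs0 *; set B := a `^ al * b `^ (1 - al).
have B0 : 0 <= B by rewrite mulr_ge0// powR_ge0.
have al1' : 0 < 1 - al by lra.
have [r [r0 rb rE]] : exists r, [/\ 0 <= r, r * b = 1 - al &
    forall z, (1 - al) * (z / b) = r * z].
  exists ((1 - al) / b); split; [by rewrite divr_ge0// ltW|by rewrite divfK// gt_eqF|].
  by move=> z; rewrite mulrA mulrAC.
have [c1' [c1'0 c1a c1E]] : exists c1', [/\ 0 <= c1', c1' * a = al &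
    forall z, al * (z / a) = c1' * z].
  exists (al / a); split; [by rewrite divr_ge0// ltW|by rewrite divfK// gt_eqF|].
  by move=> z; rewrite mulrA mulrAC.
have GB0 : 0 <= G * B by exact: mulr_ge0.
have fle' u v : f u - f v <=
    G * B * (r * (b - p * s)) + G * B * c1' * dist u v + G * B * (r * p) * (V u + V v).
  apply: (le_trans (fle u v)).
  have VV0 : 0 <= V u + V v by rewrite addr_ge0.
  have h1 := powR_amgm_at al0 al1 a0 qs0 (mdist_ge0 u v) (q0 _ VV0).
  apply: le_trans (ler_wpM2l G0 h1) _; rewrite -/B rE c1E.
  have h2 : r * q (V u + V v) <= r * (b + p * (V u + V v - s)).
    by rewrite ler_wpM2l// hp.
  by have h3 := ler_wpM2l GB0 h2; lra.
have c10 : 0 <= G * B * c1' by exact: mulr_ge0.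
apply: le_trans (pop_sub_le lf c10 fle' W) _.
have h2 : r * p * (pop V x + pop V y) <= r * p * s by rewrite ler_wpM2l// mulr_ge0.
have h3 := ler_wpM2l GB0 h2.
have GBE : G * B = G * B * (c1' * a + r * b) by rewrite c1a rb; ring.
rewrite [leRHS]GBE; lra.
Qed.

Variables (phi : R -> R) (K R0 rho delta al : R) (q : nat -> R -> R).
Hypothesis phi_ge0 : forall t, 0 <= t -> 0 <= phi t.
Hypothesis phi_subadd : forall s t, 0 <= s -> 0 <= t -> phi (s + t) <= phi s + phi t.
Hypothesis drift : forall x, pop V x <= V x - phi (V x) + K.
Hypotheses (rho_gt0 : 0 < rho) (rho_lt1 : rho < 1).
Hypothesis W_small : forall x y : E, V x + V y <= R0 ->
  (wasserstein (P x) (P y) <= ((1 - rho) * dist x y)%:E)%E.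
Hypotheses (al_gt0 : 0 < al) (al_lt1 : al < 1) (delta_gt0 : 0 < delta).
Hypothesis delta_rho : (1 - rho) `^ al * (1 + delta) <= 1.
Hypothesis q_gt0 : forall m s, 0 <= s -> 0 < q m s.
Hypothesis q_supported : forall m s, 0 <= s -> exists2 p, 0 <= p &
  forall t, 0 <= t -> q m t <= q m s + p * (t - s).
Hypothesis q_large : forall m s s', R0 < s -> 0 <= s' -> s' <= s - phi s + 2 * K ->
  q m.+1 s' <= q m s.
Hypothesis q_small : forall m s s', 0 <= s -> s <= R0 -> 0 <= s' ->
  s' <= s - phi s + 2 * K -> q m.+1 s' <= (1 + delta) * q m s.

(** The index [m] of the weight runs backwards: at [n = 0] it is [N], where
    [G * q N s `^ (1 - al) >= 1] makes the bound follow from the Lipschitz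
    property, and each application of the operator lowers it by one.  On the large
    set this is free, since the drift compensates the change of [q]; on the small
    set the contraction [(1 - rho) `^ al] pays for the factor [1 + delta]. *)
Lemma iter_pop_contraction (N : nat) (G : R) (f : E -> R) : lipschitz1 f -> 0 <= G ->
  (forall s, 0 <= s -> 1 <= G * q N s `^ (1 - al)) ->
  forall n m, (n + m)%N = N -> forall x y : E,
  iter n pop f x - iter n pop f y <=
    G * (dist x y `^ al * q m (V x + V y) `^ (1 - al)).
Proof.
move=> lf G0 GN n; have al1' : 0 < 1 - al by rewrite subr_gt0.
elim: n => [|n ih] m nm x y.
  rewrite /= in nm *; rewrite add0n in nm; rewrite nm.
  apply: (le_trans (lf x y)).
  have s0 : 0 <= V x + V y by rewrite addr_ge0.
  rewrite mulrCA; apply: (@le_trans _ _ (dist x y `^ al)).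
    have [->|d0] := eqVneq (dist x y) 0; first by rewrite powR_ge0.
    apply: ger1_powR; last exact: ltW.
    by rewrite lt_neqAle eq_sym d0 mdist_ge0 dist_le1.
  by rewrite ler_peMr ?powR_ge0// GN.
have VV0 : 0 <= V x + V y by rewrite addr_ge0.
have [->|xy] := eqVneq x y.
  rewrite subrr mulr_ge0// mulr_ge0// powR_ge0//.
have d0 : 0 < dist x y by rewrite mdist_gt0.
have nm' : (n + m.+1)%N = N by rewrite addnS -addSn.
pose s' := V x + V y - phi (V x) - phi (V y) + 2 * K.
have PVs : pop V x + pop V y <= s' by have := drift x; have := drift y; rewrite /s'; lra.
have PV0 z : 0 <= pop V z by apply: Rintegral_ge0 => t _; exact: V_ge0.
have s'0 : 0 <= s' by apply: le_trans PVs; rewrite addr_ge0.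
have s'le : s' <= V x + V y - phi (V x + V y) + 2 * K.
  by have := phi_subadd (V_ge0 x) (V_ge0 y); rewrite /s'; lra.
have step a := @pop_sub_le_concave (iter n pop f) x y al G a s' (q m.+1) al_gt0 al_lt1
  (iter_pop_lipschitz1 n lf) G0 (ih m.+1 nm') (fun t t0 => ltW (q_gt0 m.+1 t0))
  (q_gt0 m.+1 s'0) (q_supported m.+1 s'0).
have [sR|sR] := ltP R0 (V x + V y).
  apply: le_trans (step _ d0 (W_le_dist x y) PVs) _.
  rewrite ler_wpM2l// ler_wpM2l ?powR_ge0//.
  apply: ge0_ler_powR; rewrite ?nnegrE; [exact: ltW|exact/ltW/q_gt0..|].
  exact: q_large.
have a0 : 0 < (1 - rho) * dist x y by rewrite mulr_gt0// subr_gt0.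
apply: le_trans (step _ a0 (W_small sR) PVs) _; rewrite ler_wpM2l//.
rewrite powRM; [|by rewrite subr_ge0 ltW|exact: ltW].
have qle := q_small m VV0 sR s'0 s'le.
have q1 : q m.+1 s' `^ (1 - al) <= (1 + delta) * q m (V x + V y) `^ (1 - al).
  have d1 : 0 <= 1 + delta by rewrite addr_ge0// ltW.
  apply: (@le_trans _ _ (((1 + delta) * q m (V x + V y)) `^ (1 - al))).
    apply: ge0_ler_powR; rewrite ?nnegrE//; [exact: ltW|exact/ltW/q_gt0|].
    by rewrite mulr_ge0// ltW// q_gt0.
  rewrite powRM ?(ltW (q_gt0 m VV0))// ler_wpM2r ?powR_ge0//.
  by apply: ler1_powR; rewrite ?lerDl ?gerBl ltW.
have r0 : 0 <= (1 - rho) `^ al by exact: powR_ge0.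
apply: (@le_trans _ _ ((1 - rho) `^ al * dist x y `^ al *
    ((1 + delta) * q m (V x + V y) `^ (1 - al)))).
  by rewrite ler_wpM2l// mulr_ge0// powR_ge0.
rewrite mulrACA -[leRHS]mul1r ler_wpM2r// mulr_ge0// powR_ge0//.
Qed.

End Contraction.

(** * Uniqueness of laws and convergence of averages *)

Section LipschitzDetermine.
Context (R : realType) (E : completeMetricType R).
Notation dist x y := (@mdist R E x y).
Hypothesis dist_le1 : forall x y : E, dist x y <= 1.

(** The indicator of an open set [U] is the increasing limit of the functions
    [min 1 (n * dist x (~` U))], which are multiples of 1-Lipschitz ones. *)
Lemma lipschitz1_determines (mu nu : probability (borel E) R) :
  (forall f, lipschitz1 f -> \int[mu]_x f x = \int[nu]_x f x) ->
  forall A, measurable A -> mu A = nu A.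
Proof.
move=> h A mA.
have hop (U : set E) : open U -> mu (U : set (borel E)) = nu U.
  move=> oU; have mU := open_measurable_borel oU.
  have [UC|/set0P[z0 Uz0]] := eqVneq (~` U) set0.
    have -> : U = setT by rewrite -(setCK U) UC setC0.
    by rewrite !probability_setT.
  pose S x := [set dist x z | z in ~` U].
  pose f x := inf (S x).
  have S0 x : has_inf (S x).
    split; first by exists (dist x z0); exists z0.
    by exists 0 => _ [z _ <-]; exact: mdist_ge0.
  have fle x z : ~ U z -> f x <= dist x z.
    by move=> Uz; apply: (ge_inf (S0 x).2); exists z.
  have lef x c : (forall z, ~ U z -> c <= dist x z) -> c <= f x.
    by move=> hc; apply: (lb_le_inf (S0 x).1) => _ [z Uz <-]; exact: hc.
  have f0 x : 0 <= f x by apply: (lef) => z _; exact: mdist_ge0.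
  have lf : lipschitz1 f.
    move=> x y; rewrite lerBlDr -lerBlDl; apply: (lef) => z Uz.
    by have := fle x z Uz; have := metric_triangle x y z; lra.
  have fU x : U x -> 0 < f x.
    move=> Ux; have : nbhs (x : E) U by exact: open_nbhs_nbhs.
    move=> /nbhs_ballP[e /= e0 eU]; apply: lt_le_trans e0 _.
    apply: (lef) => z Uz; rewrite leNgt; apply/negP => xz; apply: Uz.
    by apply: eU; rewrite ballEmdist.
  have fC x : ~ U x -> f x = 0.
    by move=> Ux; apply/le_anti; rewrite f0 andbT -(mdistxx x) fle.
  pose g (n : nat) x := Num.min n.+1%:R^-1 (f x).
  have r0 (n : nat) : 0 < n.+1%:R^-1 :> R by rewrite invr_gt0.
  have lg n : lipschitz1 (g n).
    move=> x y; have h0 := lf x y; have d0 := mdist_ge0 x y.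
    rewrite lerBlDr /g; have [h1|h1] := leP n.+1%:R^-1 (f y).
      by rewrite ge_min lerDr d0.
    by rewrite ge_min; apply/orP; right; rewrite -lerBlDr.
  pose G (n : nat) (x : borel E) : R := n.+1%:R * g n x.
  have GM n x : `|G n x| <= 1.
    rewrite ger0_norm /G; last by rewrite mulr_ge0// /g le_min ltW//=.
    by rewrite -ler_pdivlMl// mulr1 /g ge_min lexx.
  have mG n : measurable_fun setT (G n : borel E -> R).
    apply: measurable_funM => //; exact: lipschitz1_measurable.
  have Gcvg x : G n x @[n --> \oo] --> (\1_(U : set (borel E)) x : R).
    have [Ux|Ux] := pselect (U x); last first.
      rewrite indicE memNset//; apply: cvg_near_cst; apply: nearW => n.
      by rewrite /G /g fC// min_r ?mulr0// ltW.
    rewrite indicE mem_set//; apply: cvg_near_cst.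
    have /cvgrPdist_lt/(_ _ (fU x Ux)) := @cvg_harmonic R.
    apply: filterS => n; rewrite /= sub0r normrN ger0_norm// => hn.
    by rewrite /G /g min_l ?divff// ltW.
  have m1 (m : probability (borel E) R) := @mean_cvg _ (borel E) R m G (\1_(U : set (borel E))) 1 mG (measurable_indic mU) GM Gcvg.
  have e n : \int[mu]_x G n x = \int[nu]_x G n x.
    rewrite /G !RintegralZl ?h//; exact: lipschitz1_integrable.
  have : fine (mu (U : set (borel E))) = fine (nu (U : set (borel E))).
    rewrite -!mean_indic//.
    apply: (@cvg_unique _ (@Rhausdorff R) (\int[mu]_x G n x @[n --> \oo])); first exact: m1.
    have -> : (fun n => \int[mu]_x G n x) = (fun n => \int[nu]_x G n x) by exact/funext.
    exact: m1.
  by move=> /(congr1 (@EFin R)); rewrite !fineK// fin_num_measure.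
apply: (@measure_unique _ R (borel E) (@open E) (fun=> setT)) => //.
- by move=> U U'; exact: openI.
- by move=> _; exact: openT.
- exact: bigcup_const.
- by move=> _; rewrite /= probability_setT ltry.
Qed.

End LipschitzDetermine.

Section Cesaro.
Context (R : realType).

(** [b n] is close to every average of the later terms, and long averages
    forget where they start; hence [b] is Cauchy. *)
Lemma cesaro_limit (b e : nat -> R) (B : R) :
  (forall n, `|b n| <= B) -> e @ \oo --> 0 ->
  (forall n M, `|b n - (\sum_(k < M.+1) b (n + k)%N) / M.+1%:R| <= e n) ->
  exists l, b @ \oo --> l /\ forall n, `|b n - l| <= e n.
Proof.
move=> bB e0 be.
have B0 : 0 <= B by apply: le_trans (bB 0%N).
pose A n M := \sum_(k < M) b (n + k)%N.
have AS n M : A n.+1 M - A n M = b (n + M)%N - b n.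
  elim: M => [|M ih]; first by rewrite /A !big_ord0 addn0 !subrr.
  by rewrite /A !big_ord_recr/= -/(A n.+1 M) -/(A n M) addSnnS; lra.
have A0 n M : `|A n M - A 0%N M| <= n%:R * (2 * B).
  elim: n => [|n ih]; first by rewrite subrr normr0 mul0r.
  have -> : A n.+1 M - A 0%N M = (b (n + M)%N - b n) + (A n M - A 0%N M).
    by rewrite -AS; lra.
  apply: le_trans (ler_normD _ _) _; have := ler_normB (b (n + M)%N) (b n).
  by have := bB (n + M)%N; have := bB n; rewrite -natr1; lra.
have bb n m : `|b n - b m| <= e n + e m.
  apply/ler_addgt0Pr => eps eps0.
  pose c := (n%:R + m%:R) * (2 * B).
  have c0 : 0 <= c by rewrite mulr_ge0 ?addr_ge0// mulr_ge0.
  pose M := Num.truncn (c / eps).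
  have Mc : c / M.+1%:R <= eps.
    rewrite ler_pdivrMr// mulrC -ler_pdivrMr//; apply/ltW.
    exact: truncnS_gt.
  have h1 : `|b n - A n M.+1 / M.+1%:R| <= e n := be n M.
  have h2 : `|b m - A m M.+1 / M.+1%:R| <= e m := be m M.
  have h3 : `|A n M.+1 / M.+1%:R - A m M.+1 / M.+1%:R| <= eps.
    rewrite -mulrBl normrM [X in _ * X]ger0_norm ?invr_ge0//.
    apply: le_trans Mc; rewrite ler_pM2r ?invr_gt0//.
    have -> : A n M.+1 - A m M.+1 = (A n M.+1 - A 0%N M.+1) - (A m M.+1 - A 0%N M.+1) by lra.
    apply: le_trans (ler_normB _ _) _; rewrite /c mulrDl.
    by apply: lerD.
  move: h1 h2 h3; move: (A n M.+1 / _) (A m M.+1 / _) => X Y; rewrite !ler_norml.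
  by move=> /andP[? ?] /andP[? ?] /andP[? ?]; apply/andP; split; lra.
have cb : cvgn b.
  apply: cauchy_cvg; apply: cauchy_exP => eps eps0.
  have eps2 : 0 < eps / 2 by lra.
  have /cvgrPdist_lt/(_ _ eps2)[N _ hN] := e0.
  exists (b N); exists N => // m /= Nm; rewrite /ball /=.
  apply: le_lt_trans (bb N m) _.
  have := hN N (leqnn N); have := hN m Nm; rewrite /= !sub0r !normrN.
  by have := ler_norm (e N); have := ler_norm (e m); lra.
exists (lim (b @ \oo)); split => // n.
apply/ler_addgt0Pr => eps eps0.
have eps2 : 0 < eps / 2 by lra.
have : \forall m \near \oo, `|b n - lim (b @ \oo)| <= e n + eps.
  have /cvgrPdist_lt/(_ _ eps2) h1 := cb.
  have /cvgrPdist_lt/(_ _ eps2) h2 := e0.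
  near=> m.
  have : `|lim (b @ \oo) - b m| < eps / 2 by near: m.
  have : `|0 - e m| < eps / 2 by near: m.
  rewrite sub0r normrN => /(le_lt_trans (ler_norm _)) h3.
  have := bb n m; rewrite !ltr_norml !ler_norml => /andP[? ?] /andP[? ?].
  by apply/andP; split; lra.
by case=> m _ /(_ m (leqnn m)).
Unshelve. all: by end_near. Qed.

End Cesaro.

(** * Transition probabilities of the chain *)

Section Transitions.
Context (R : realType) (E : completeMetricType R).
Context dO (Omega : measurableType dO).
Variables (PP : borel E -> probability Omega R) (X : nat -> {mfun Omega >-> borel E}).
Hypothesis hX : homogeneous_markov_chain PP X.
Notation Q := (transition PP X).

Lemma transition_measurable (A : set (borel E)) : measurable A ->
  measurable_fun setT (Q 1%N ^~ A).
Proof. by move=> mA; have [_ + _] := hX; apply. Qed.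

Lemma transition0 x (A : set (borel E)) : measurable A -> Q 0%N x A = dirac x A.
Proof.
move=> mA; have [h0 _ _] := hX.
have mx : measurable ([set x] : set (borel E)).
  rewrite -[X in measurable X]setCK; apply: measurableC.
  apply: open_measurable_borel; apply: closed_openC.
  exact/accessible_closed_set1/hausdorff_accessible/(@metric_hausdorff _ E).
have Qx : Q 0%N x [set x] = 1%E by exact: h0.
have mono (B C : set (borel E)) : measurable B -> measurable C -> B `<=` C ->
    (Q 0%N x B <= Q 0%N x C)%E.
  by move=> mB mC BC; apply: le_measure; rewrite ?inE.
have full (B : set (borel E)) : measurable B -> B x -> Q 0%N x B = 1%E.
  move=> mB Bx; apply/le_anti/andP; split; first exact: probability_le1.
  by rewrite -Qx; apply: mono => // _ ->.
rewrite diracE; have [xA|/negP xA] := boolP (x \in A).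
  by rewrite full//; exact: set_mem.
have : (Q 0%N x (~` A) = 1)%E.
  by apply: full; [exact: measurableC|move=> /mem_set].
rewrite probability_setC// => h.
have QA : Q 0%N x A \is a fin_num by exact: fin_num_measure.
move: h; rewrite -(fineK QA) -EFinB => -[h]; congr (_%:E).
by rewrite /=; lra.
Qed.

Lemma transitionS n x (A : set (borel E)) : measurable A ->
  Q n.+1 x A = (\int[Q n x]_y Q 1%N y A)%E.
Proof.
move=> mA; have [_ _ h] := hX.
have hT : natural_filtration X n setT.
  have [s0 sC _] := smallest_sigma_algebra setT
    (\bigcup_(k in `I_n.+1) preimage_set_system setT (X k) measurable).
  by have := sC _ s0; rewrite setD0.
have h1 := h x n A setT mA hT; rewrite setTI in h1; apply: (etrans h1).
apply/esym; rewrite /transition.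
by apply: (@ge0_integral_pushforward _ _ _ _ _ (X n) _ (PP x) setT (fun y => Q 1%N y A)) => //;
  exact: transition_measurable.
Qed.

End Transitions.

(** * Convergence to the stationary law *)

Section Ergodic.
Context (R : realType) (E : completeMetricType R).
Notation dist x y := (@mdist R E x y).
Hypothesis hsep : separable E.
Hypothesis dist_le1 : forall x y : E, dist x y <= 1.
Variable Q : nat -> borel E -> probability (borel E) R.
Hypothesis mQ : forall A, measurable A -> measurable_fun setT (Q 1%N ^~ A).
Hypothesis Q0 : forall x A, measurable A -> Q 0%N x A = dirac x A.
Hypothesis QS : forall n x A, measurable A -> Q n.+1 x A = (\int[Q n x]_y Q 1%N y A)%E.
Variables (V : borel E -> R) (phi : R -> R) (K R0 rho : R).
Hypothesis V_meas : measurable_fun setT V.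
Hypothesis V_ge0 : forall x, 0 <= V x.
Hypothesis phi_concave : forall t x y : R, 0 <= t -> t <= 1 -> 0 <= x -> 0 <= y ->
  t * phi x + (1 - t) * phi y <= phi (t * x + (1 - t) * y).
Hypothesis phi_lt : forall x y : R, 0 <= x -> x < y -> phi x < phi y.
Hypothesis phi0 : phi 0 = 0.
Hypothesis phi_cont : {within `[0, +oo[, continuous phi}.
Hypothesis K_ge0 : 0 <= K.
Hypothesis drift : forall x,
  (\int[Q 1%N x]_t (V t)%:E <= (V x - phi (V x) + K)%:E)%E.
Hypothesis W_le_dist : forall x y : E,
  (wasserstein (Q 1%N x) (Q 1%N y) <= (dist x y)%:E)%E.
Hypotheses (R0_gt0 : 0 < R0) (R0_large : 2 * K < phi R0).
Hypotheses (rho_gt0 : 0 < rho) (rho_lt1 : rho < 1).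
Hypothesis W_small : forall x y : E, V x + V y <= R0 ->
  (wasserstein (Q 1%N x) (Q 1%N y) <= ((1 - rho) * dist x y)%:E)%E.

Notation P := (Q 1%N).
Notation T := (pop P).

Lemma phiV_measurable : measurable_fun setT (phi \o V).
Proof.
have m0 : measurable (`[0, +oo[ : set R) by exact: measurable_itv.
have mphi : measurable_fun (`[0, +oo[ : set R) phi by exact: subspace_continuous_measurable_fun.
apply: (measurable_comp m0) => //.
by move=> _ [x _ <-] /=; rewrite in_itv/= V_ge0.
Qed.

Lemma phiV_le x : phi (V x) <= phi 1 * (1 + V x).
Proof.
have V1 : 1 <= 1 + V x by rewrite lerDl.
apply: le_trans (phi_le phi_lt (V_ge0 x) (_ : V x <= 1 + V x)) _; first by rewrite lerDr.
by have := phi_scale phi_concave phi0 ler01 V1; rewrite mul1r mulrC.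
Qed.

Lemma phiV_ge0 x : 0 <= phi (V x).
Proof. exact: phi_ge0. Qed.

Lemma V_integrable_P x : (P x).-integrable setT (EFin \o V).
Proof.
apply/integrableP; split; first exact/measurable_EFinP.
under eq_integral => t _ do rewrite /= ger0_norm//.
exact: le_lt_trans (drift x) (ltry _).
Qed.

Lemma V_EFin x : (\int[P x]_t (V t)%:E)%E = (T V x)%:E.
Proof.
rewrite /pop /Rintegral fineK//.
exact: (integrable_fin_num measurableT (V_integrable_P x)).
Qed.

Lemma drift_pop x : T V x <= V x - phi (V x) + K.
Proof. by rewrite -lee_fin -V_EFin. Qed.

Lemma pop_V_ge0 x : 0 <= T V x.
Proof. by apply: Rintegral_ge0 => t _. Qed.

Lemma pop_V_measurable : measurable_fun setT (T V : borel E -> R).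
Proof.
have mV : measurable_fun setT (EFin \o V) by exact/measurable_EFinP.
have V0 x : (0 <= (EFin \o V) x)%E by rewrite lee_fin.
have := measurable_kernel_integral mQ mV V0.
by rewrite (_ : (fun x => _) = EFin \o (T V)); [move/measurable_EFinP|apply/funext => x; exact: V_EFin].
Qed.

Lemma integrable_dominated (m : probability (borel E) R) (f g : borel E -> R) :
  measurable_fun setT f -> (forall x, 0 <= f x <= g x) ->
  m.-integrable setT (EFin \o g) -> m.-integrable setT (EFin \o f).
Proof.
move=> mf fg; apply: le_integrable => //; first exact/measurable_EFinP.
move=> x _ /=; rewrite lee_fin; have /andP[f0 fgx] := fg x.
by rewrite !ger0_norm// (le_trans f0).
Qed.

Lemma pop_V_integrable (m : probability (borel E) R) :
  m.-integrable setT (EFin \o V) -> m.-integrable setT (EFin \o (T V)).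
Proof.
move=> Vi; apply: (integrable_dominated pop_V_measurable (g := fun x => V x + K)).
  by move=> x; rewrite pop_V_ge0/=; have := drift_pop x; have := phiV_ge0 x; lra.
exact: integrable_add Vi (cst_integrable m K).
Qed.

Lemma phiV_integrable (m : probability (borel E) R) :
  m.-integrable setT (EFin \o V) -> m.-integrable setT (EFin \o (phi \o V)).
Proof.
move=> Vi; apply: (integrable_dominated phiV_measurable (g := fun x => phi 1 * (1 + V x))).
  by move=> x; rewrite phiV_ge0 phiV_le.
exact: integrable_scale (integrable_add (cst_integrable m 1) Vi).
Qed.

Lemma Q0_dirac x (f : borel E -> R) : measurable_fun setT f -> (forall y, 0 <= f y) ->
  (\int[Q 0%N x]_t (f t)%:E = (f x)%:E)%E.
Proof.
move=> mf f0.
rewrite (@eq_measure_integral _ _ _ setT (dirac x)); last by move=> A mA _; exact: Q0.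
rewrite integral_dirac//; last exact/measurable_EFinP.
by rewrite diracT mul1e.
Qed.

(** Integrability propagates along the chain because the drift bounds [T V] by
    [V + K]. *)
Lemma V_integrable n x : (Q n x).-integrable setT (EFin \o V) /\
  \int[Q n.+1 x]_t V t = \int[Q n x]_t T V t.
Proof.
have mV : measurable_fun setT (EFin \o V) by exact/measurable_EFinP.
have V0 y : (0 <= (EFin \o V) y)%E by rewrite lee_fin.
have VS m : (\int[Q m.+1 x]_t (V t)%:E = \int[Q m x]_t (T V t)%:E)%E.
  rewrite (kernel_integral mQ (QS m x) mV V0).
  by apply: eq_integral => y _; exact: V_EFin.
split; last by rewrite /Rintegral VS.
apply/integrableP; split => //.
under eq_integral => t _ do rewrite /= ger0_norm//.
elim: n => [|n ih]; first by rewrite Q0_dirac// ltry.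
have Vi : (Q n x).-integrable setT (EFin \o V).
  apply/integrableP; split => //.
  by under eq_integral => t _ do rewrite /= ger0_norm//.
rewrite VS; have /integrableP[_] := pop_V_integrable Vi.
by under eq_integral => t _ do rewrite /= ger0_norm ?pop_V_ge0//.
Qed.

Lemma Q_pop n x f : lipschitz1 f -> \int[Q n x]_t f t = iter n T f x.
Proof.
elim: n f => [|n ih] f lf.
  rewrite /Rintegral (@eq_measure_integral _ _ _ setT (dirac x)); last by move=> A mA _; exact: Q0.
  rewrite integral_dirac//; last by apply/measurable_EFinP; exact: lipschitz1_measurable lf.
  by rewrite diracT mul1e.
have lTf : lipschitz1 (T f) := pop_lipschitz1 hsep dist_le1 V_integrable_P W_le_dist lf.
rewrite iterSr -ih//.
have mf := lipschitz1_measurable lf.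
by have [_ ->] := kernel_mean mQ (QS n x) mf (lipschitz1_bounded dist_le1 lf).
Qed.

(** Summing the drift inequality along the trajectory; [V] itself telescopes. *)
Lemma occupation_bound M x :
  \sum_(k < M) \int[Q k x]_t phi (V t) <= V x + M%:R * K.
Proof.
suff : \sum_(k < M) \int[Q k x]_t phi (V t) + \int[Q M x]_t V t <= V x + M%:R * K.
  have : 0 <= \int[Q M x]_t V t by apply: Rintegral_ge0 => t _.
  lra.
elim: M => [|M ih].
  by rewrite big_ord0 add0r mul0r addr0 /Rintegral Q0_dirac.
rewrite big_ord_recr/= (V_integrable M x).2.
have Vi := (V_integrable M x).1; have pVi := phiV_integrable Vi.
have Vpi := integrable_sub Vi pVi.
have := le_Rintegral measurableT (pop_V_integrable Vi)
  (integrable_add Vpi (cst_integrable _ K)) (fun y _ => drift_pop y).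
rewrite (RintegralD measurableT Vpi (cst_integrable _ K)) mean_cst.
rewrite (RintegralB measurableT Vi pVi) -natr1 /=.
lra.
Qed.

Lemma iter_pop_bounded n f : lipschitz1 f -> forall x, `|iter n T f x| <= `|f point| + 1.
Proof.
move=> lf x; rewrite -Q_pop//.
have fi := lipschitz1_integrable dist_le1 (Q n x) lf.
apply: le_trans (le_normr_Rintegral _ fi) _ => //.
rewrite -[leRHS](mean_cst (Q n x)); apply: le_Rintegral => //.
- by have := integrable_norm fi.
- exact: cst_integrable.
- by move=> t _; exact: lipschitz1_bounded.
Qed.

Notation rate k n := (phi (iter n (step phi k) 1)).

(** Comparing [P^n f] at [x] with [P^(n + j) f] at [x] amounts to comparing
    [P^n f] at [x] and at the position after [j] steps.  The bound grows like
    [phi (V _)] at that position, whose average over [j] is controlled by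
    [occupation_bound].  Comparing with the stationary law directly would require
    [V] to be integrable for it, which may fail. *)
Lemma averaging_rate (al : R) : 0 < al -> al < 1 -> exists k C, [/\ 0 < k, 0 < C &
  forall f, lipschitz1 f -> forall n M x,
  `|iter n T f x - (\sum_(j < M.+1) iter (n + j)%N T f x) / M.+1%:R| <=
    C * (1 + V x) / rate k n `^ (1 - al) /\
  forall y, `|iter n T f x - iter n T f y| <= C * (1 + V x + V y) / rate k n `^ (1 - al)].
Proof.
move=> al0 al1; have al1' : 0 < 1 - al by rewrite subr_gt0.
have rr : 0 < (1 - rho) `^ al by rewrite powR_gt0// subr_gt0.
have rr1 : (1 - rho) `^ al < 1.
  have rho01 : 0 <= 1 - rho by rewrite subr_ge0 ltW.
  have : (1 - rho) `^ al < 1 `^ al.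
    by apply: gt0_ltr_powR; rewrite ?nnegrE// gtrBl.
  by rewrite powR1.
pose delta := ((1 - rho) `^ al)^-1 - 1.
have d0 : 0 < delta by rewrite subr_gt0 invf_gt1.
have drho : (1 - rho) `^ al * (1 + delta) <= 1.
  have -> : 1 + delta = ((1 - rho) `^ al)^-1 by rewrite /delta addrC subrK.
  by rewrite divff// gt_eqF.
have [k [L [k0 L0 qlarge qsmall]]] :=
  lyapunov_family phi_concave phi_lt phi0 R0_gt0 K_ge0 R0_large d0.
have p1 : 0 < phi 1 by exact: phi_gt0.
have rate0 n : 0 < rate k n by exact: rate_gt0.
have rateq m s : 0 <= s -> rate k m <= lyapunov phi k L m s by exact: rate_le_lyapunov.
have q0 m s : 0 <= s -> 0 < lyapunov phi k L m s.
  by move=> s0; exact: lt_le_trans (rate0 m) (rateq m s s0).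
have qsup m s := lyapunov_supported phi_concave phi_lt phi0 k0 L0 m (s0 := s).
exists k, (2 + 3 * phi 1 + K); split => //.
  by apply: ltr_wpDr => //; rewrite addr_gt0// mulr_gt0.
move=> f lf n M x.
pose G := (rate k n `^ (1 - al))^-1.
have G0 : 0 <= G by rewrite invr_ge0 powR_ge0.
have GN s : 0 <= s -> 1 <= G * lyapunov phi k L n s `^ (1 - al).
  move=> s0; rewrite mulrC ler_pdivlMr ?powR_gt0// mul1r.
  by apply: ge0_ler_powR; rewrite ?nnegrE; [exact: ltW|exact/ltW/rate0|exact/ltW/q0|exact: rateq].
have subadd := phi_subadd phi_concave phi0.
have contr := iter_pop_contraction hsep dist_le1 V_ge0 V_integrable_P W_le_dist
  subadd drift_pop rho_lt1 W_small al0 al1 d0 drho q0 qsup qlarge qsmall lf G0 GN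
  (addn0 n).
pose g := iter n T f.
have lg : lipschitz1 g by exact: (iter_pop_lipschitz1 hsep dist_le1 V_integrable_P W_le_dist).
pose bnd y z := G * (1 + phi 1 + phi (V y) + phi (V z)).
have gb y z : g y - g z <= bnd y z.
  apply: (le_trans (contr y z)); rewrite ler_wpM2l//.
  have VV0 : 0 <= V y + V z by rewrite addr_ge0.
  set t := lyapunov _ _ _ _ _.
  have t0 : 0 <= t by exact/ltW/q0.
  have tle : t <= phi 1 + phi (V y) + phi (V z).
    apply: (le_trans (lyapunov0_le _ _ _ _)).
    have := subadd _ _ ler01 VV0; have := subadd _ _ (V_ge0 y) (V_ge0 z); lra.
  have d1 : dist y z `^ al <= 1.
    have -> : 1 = 1 `^ al :> R by rewrite powR1.
    by apply: ge0_ler_powR; rewrite ?nnegrE ?mdist_ge0//; exact: ltW.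
  have t1 : t `^ (1 - al) <= 1 + t.
    have [t1|t1] := leP t 1.
      have : t `^ (1 - al) <= 1 `^ (1 - al).
        by apply: ge0_ler_powR; rewrite ?nnegrE//; exact: ltW.
      by rewrite powR1; lra.
    have : t `^ (1 - al) <= t by apply: ler1_powR; [exact: ltW|rewrite gerBl ltW].
    lra.
  have := ler_wpM2r (powR_ge0 t (1 - al)) d1; rewrite mul1r; lra.
have gbn y z : `|g y - g z| <= bnd y z.
  rewrite ler_norml; apply/andP; split; last exact: gb.
  by rewrite lerNl opprB; apply: (le_trans (gb z y)); rewrite /bnd; lra.
have gint j : `|g x - iter (n + j)%N T f x| <=
    G * (1 + phi 1 + phi (V x) + \int[Q j x]_t phi (V t)).
  rewrite addnC iterD -/g -Q_pop//.
  have gi := lipschitz1_integrable dist_le1 (Q j x) lg.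
  have pVi := phiV_integrable (V_integrable j x).1.
  have ci := cst_integrable (Q j x).
  have di := integrable_sub (ci (g x)) gi.
  rewrite -[X in X - _](mean_cst (Q j x) (g x)) -(RintegralB _ (ci _) gi)//.
  apply: le_trans (le_normr_Rintegral _ di) _ => //.
  have si := integrable_add (ci (1 + phi 1 + phi (V x))) pVi.
  have := le_Rintegral measurableT (integrable_norm di) (integrable_scale G si)
    (fun t _ => gbn x t).
  rewrite (RintegralZl G measurableT si) (RintegralD measurableT (ci _) pVi) mean_cst.
  by [].
split; last first.
  move=> y; apply: (le_trans (gbn x y)); rewrite /bnd mulrC ler_pM2r ?invr_gt0 ?powR_gt0//.
  have := phiV_le x; have := phiV_le y; have := V_ge0 x; have := V_ge0 y; have := K_ge0.
  have : 0 <= K * (V x + V y) by rewrite mulr_ge0// addr_ge0.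
  have : 0 <= phi 1 * (V x + V y) by rewrite mulr_ge0 ?addr_ge0// ltW.
  nra.
have M0 : 0 < M.+1%:R :> R by [].
have -> : g x - (\sum_(j < M.+1) iter (n + j)%N T f x) / M.+1%:R =
    (\sum_(j < M.+1) (g x - iter (n + j)%N T f x)) / M.+1%:R.
  by rewrite sumrB mulrBl sumr_const card_ord -[g x *+ _]mulr_natr mulfK// gt_eqF.
rewrite normrM [X in _ * X]ger0_norm ?invr_ge0 ?(ltW M0)// ler_pdivrMr//.
apply: (le_trans (ler_norm_sum _ _ _)).
apply: le_trans (ler_sum _ (fun (j : 'I_M.+1) _ => gint j)) _.
rewrite -mulr_sumr big_split/= sumr_const card_ord -[(1 + _ + _) *+ _]mulr_natr.
have occ := occupation_bound M.+1 x.
have V0 := V_ge0 x; have pV := phiV_le x.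
have VM : V x <= V x * M.+1%:R by rewrite ler_peMr// ler1n.
rewrite [leRHS]mulrAC -/G [leRHS]mulrC ler_wpM2l//.
have : phi (V x) * M.+1%:R <= phi 1 * (1 + V x) * M.+1%:R by rewrite ler_wpM2r// ltW.
have : 0 <= (V x * phi 1 + V x * K) * M.+1%:R.
  by rewrite mulr_ge0 ?(ltW M0)// addr_ge0// mulr_ge0// ltW.
have : 0 <= V x * M.+1%:R by rewrite mulr_ge0// ltW.
nra.
Qed.

Hypothesis phi_infty : phi t @[t --> +oo] --> +oo.

Lemma rate_inv_cvg (k A b : R) : 0 < k -> 0 <= A -> 0 < b ->
  A / rate k n `^ b @[n --> \oo] --> 0.
Proof.
move=> k0 A0 b0; apply/cvgrPdist_le => e e0.
have p1 : 0 < phi 1 by exact: phi_gt0.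
pose Z := (A / e + 1) `^ b^-1.
have Z0 : 0 <= Z by exact: powR_ge0.
have [t [treal ht]] : exists t, t \is Num.real /\ forall s, t < s -> Z <= phi s.
  by move/cvgryPge : phi_infty => /(_ Z).
pose N := (Num.truncn (`|t| / (k * phi 1))).+1.
exists N => // n /= Nn.
have kp : 0 < k * phi 1 by rewrite mulr_gt0.
have tn : t < iter n (step phi k) 1.
  apply: le_lt_trans (ler_norm t) _.
  apply: lt_le_trans (iter1_ge_lin phi_lt phi0 k0 n).
  have : `|t| < N%:R * (k * phi 1) by rewrite -ltr_pdivrMr// truncnS_gt.
  have : N%:R * (k * phi 1) <= n%:R * (k * phi 1) 
    by apply: ler_wpM2r; [exact: ltW|rewrite ler_nat].
  lra.
have AZ : A / e + 1 <= rate k n `^ b.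
  have Ae : 0 <= A / e + 1 by rewrite addr_ge0// divr_ge0// ltW.
  have -> : A / e + 1 = Z `^ b by rewrite /Z -powRrM mulVf ?gt_eqF// powRr1.
  apply: ge0_ler_powR; rewrite ?nnegrE//; [exact: ltW| |exact: ht].
  exact/ltW/(rate_gt0 phi_lt phi0 k0).
have r0 : 0 < rate k n `^ b by rewrite powR_gt0// (rate_gt0 phi_lt phi0 k0).
rewrite sub0r normrN ger0_norm; last by rewrite divr_ge0// ltW.
rewrite ler_pdivrMr// -ler_pdivrMl// mulrC; lra.
Qed.

(** The limits of [P^n f] exist by [cesaro_limit] and do not depend on the starting
    point; they are the means of [f] under one law by completeness.  The law is
    obtained from the exponent [1/2], and the limits being the same for every
    [al], so are the rates around it. *)
Lemma ergodic_measure : exists pi : probability (borel E) R,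
  (forall f, lipschitz1 f -> forall x,
     iter n T f x @[n --> \oo] --> \int[pi]_t f t) /\
  forall al, 0 < al -> al < 1 -> exists k C, [/\ 0 < k, 0 < C &
    forall f, lipschitz1 f -> forall n x,
      `|iter n T f x - \int[pi]_t f t| <= C * (1 + V x) / rate k n `^ (1 - al)].
Proof.
have lim_ex al : 0 < al -> al < 1 -> exists k C, [/\ 0 < k, 0 < C &
    forall f, lipschitz1 f -> forall x, exists l, iter n T f x @[n --> \oo] --> l /\
      forall n, `|iter n T f x - l| <= C * (1 + V x) / rate k n `^ (1 - al)].
  move=> al0 al1; have [k [C [k0 C0 h]]] := averaging_rate al0 al1.
  exists k, C; split => // f lf x.
  apply: (@cesaro_limit R (fun n => iter n T f x) _ (`|f point| + 1)).
  - by move=> n; exact: iter_pop_bounded.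
  - by apply: rate_inv_cvg; rewrite ?subr_gt0// mulr_ge0 ?(ltW C0)// addr_ge0.
  - by move=> n M; have [] := h f lf n M x.
have h0 : 0 < 2^-1 :> R by rewrite invr_gt0.
have h1 : 2^-1 < 1 :> R by rewrite invf_lt1// ltr1n.
have [k [C [k0 C0 hl]]] := lim_ex _ h0 h1.
pose L f := lim (iter n T f point @[n --> \oo]).
have LE f x : lipschitz1 f -> iter n T f x @[n --> \oo] --> L f.
  move=> lf; have [l [cl _]] := hl f lf point.
  have cL : iter n T f point @[n --> \oo] --> L f by apply/cvg_ex; exists l.
  have [k' [C' [k0' C0' h]]] := averaging_rate h0 h1.
  have A0 : 0 <= C' * (1 + V x + V point) by rewrite mulr_ge0 ?(ltW C0')// !addr_ge0.
  have h1' : 0 < 1 - 2^-1 :> R by rewrite subr_gt0.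
  have r0 := rate_inv_cvg k0' A0 h1'.
  have d0 : (iter n T f x - iter n T f point) @[n --> \oo] --> (0 : R).
    apply/cvgrPdist_le => e e0; have /cvgrPdist_le/(_ _ e0) := r0.
    apply: filterS => n; rewrite !sub0r !normrN => hn.
    apply: le_trans hn; apply: le_trans _ (ler_norm _).
    by have [_] := h f lf n 0%N x; apply.
  have c := cvgD d0 cL; rewrite add0r in c.
  have -> : (fun n => iter n T f x) =
      (fun n => iter n T f x - iter n T f point + iter n T f point).
    by apply/funext => n; rewrite subrK.
  exact: c.
have [pi piE] : exists pi : probability (borel E) R,
    forall f, lipschitz1 f -> \int[pi]_x f x = L f.
  apply: (lipschitz1_limit_measure hsep dist_le1 (mu := fun n => Q n point)
    (e := fun n => C * (1 + V point) / rate k n `^ (1 - 2^-1))).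
    by apply: rate_inv_cvg; rewrite ?subr_gt0// mulr_ge0 ?(ltW C0)// addr_ge0.
  move=> f lf n; rewrite Q_pop//; have [l [cl hn]] := hl f lf point.
  by have <- : l = L f by exact: (cvg_unique (@Rhausdorff R) cl (LE f point lf)).
exists pi; split => [f lf x|al al0 al1]; first by rewrite piE//; exact: LE.
have [k' [C' [k0' C0' h]]] := lim_ex _ al0 al1; exists k', C'; split => // f lf n x.
have [l [cl hn]] := h f lf x; rewrite piE//.
by have <- : l = L f by exact: (cvg_unique (@Rhausdorff R) cl (LE f x lf)).
Qed.

(** [P^n (P f)] and [P^n f] have the same limit. *)
Lemma limit_stationary (pi : probability (borel E) R) :
  (forall f, lipschitz1 f -> forall x,
     iter n T f x @[n --> \oo] --> \int[pi]_t f t) ->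
  stationary P pi.
Proof.
move=> hpi; have [nu nuE] := kernel_bind mQ pi.
have e f : lipschitz1 f -> \int[nu]_t f t = \int[pi]_t f t.
  move=> lf; have mf := lipschitz1_measurable lf.
  have [_ ->] := kernel_mean mQ nuE mf (lipschitz1_bounded dist_le1 lf).
  have lTf : lipschitz1 (T f) := pop_lipschitz1 hsep dist_le1 V_integrable_P W_le_dist lf.
  have c1 := hpi _ lTf point; have c2 := hpi _ lf point.
  apply: (cvg_unique (@Rhausdorff R) c1).
  have -> : (fun n => iter n T (T f) point) = (fun n => iter n.+1 T f point).
    by apply/funext => n; rewrite iterSr.
  by rewrite -(cvg_shiftS (fun n => iter n T f point)) in c2.
move=> A mA; rewrite /markov_measure -nuE//.
exact: (lipschitz1_determines dist_le1 e mA).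
Qed.

(** A stationary law gives [P^n f] and [f] the same mean, and the mean of [P^n f]
    tends to that of the limit constant. *)
Lemma stationary_unique (pi pi' : probability (borel E) R) :
  (forall f, lipschitz1 f -> forall x,
     iter n T f x @[n --> \oo] --> \int[pi]_t f t) ->
  stationary P pi' -> forall A, measurable A -> pi' A = pi A.
Proof.
move=> hpi spi' A mA; apply: (lipschitz1_determines dist_le1) => // f lf.
have mf g : lipschitz1 g -> measurable_fun setT (g : borel E -> R).
  exact: lipschitz1_measurable.
have lT n g : lipschitz1 g -> lipschitz1 (iter n T g).
  exact: (iter_pop_lipschitz1 hsep dist_le1 V_integrable_P W_le_dist).
have inv g : lipschitz1 g -> \int[pi']_t T g t = \int[pi']_t g t.
  move=> lg; have sE B : measurable B -> pi' B = (\int[pi']_t P t B)%E.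
    by move=> mB; rewrite -[LHS](spi' B mB).
  by have [_ ->] := kernel_mean mQ sE (mf g lg) (lipschitz1_bounded dist_le1 lg).
have invn n : \int[pi']_t iter n T f t = \int[pi']_t f t.
  by elim: n => //= n ih; rewrite inv//; exact: lT.
have c := @mean_cvg _ _ _ pi' (fun n => iter n T f) (fun=> \int[pi]_t f t) _
  (fun n => mf _ (lT n f lf)) (measurable_cst _) (fun n x => iter_pop_bounded n lf x)
  (fun x => hpi f lf x).
rewrite mean_cst in c; apply: (cvg_unique (@Rhausdorff R) _ c).
by apply: cvg_near_cst; apply: nearW => n; rewrite invn.
Qed.

(** [V] may fail to be integrable, so the drift inequality is integrated for the
    truncation [min V M], whose means under the law and after one step are finite
    and cancel. *)
Lemma stationary_moment (pi : probability (borel E) R) : stationary P pi ->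
  (\int[pi]_u (phi (V u))%:E <= K%:E)%E.
Proof.
move=> spi.
have sE B : measurable B -> pi B = (\int[pi]_t P t B)%E.
  by move=> mB; rewrite -[LHS](spi B mB).
pose U (M : nat) x := Num.min (V x) M%:R.
have mU M : measurable_fun setT (U M) by exact: measurable_minr.
have UM M x : `|U M x| <= M%:R.
  by rewrite ger0_norm /U ?ge_min ?lexx ?orbT// le_min V_ge0/=.
have Ui M (m : probability (borel E) R) : m.-integrable setT (EFin \o U M) := bounded_integrable m (mU M) (UM M).
pose F (M : nat) x := phi (V x) * \1_[set x | V x <= M%:R] x.
have mVM M : measurable [set x : borel E | V x <= M%:R].
  rewrite -[X in measurable X]setTI; rewrite (_ : [set x | _] = V @^-1` `]-oo, M%:R]).
    exact: V_meas.
  by apply/seteqP; split => x /=; rewrite in_itv.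
have mF M : measurable_fun setT (F M).
  by apply: measurable_funM => //; exact: phiV_measurable.
have F0 M x : 0 <= F M x by rewrite mulr_ge0 ?phiV_ge0.
have FE M x : F M x = if V x <= M%:R then phi (V x) else 0.
  by rewrite /F indicE; case: ifPn => h; [rewrite mem_set ?mulr1|rewrite memNset ?mulr0//; exact/negP].
have FM M x : `|F M x| <= phi M%:R.
  rewrite ger0_norm// FE; case: ifP => h; last exact: phi_ge0.
  exact: phi_le.
have TU M x : T (U M) x <= U M x - F M x + K.
  have h1 : T (U M) x <= M%:R.
    have UleM t : U M t <= M%:R by rewrite /U ge_min lexx orbT.
    have := le_Rintegral measurableT (Ui M (P x)) (cst_integrable (P x) M%:R)
      (fun t _ => UleM t).
    by rewrite mean_cst.
  have h2 : T (U M) x <= T V x.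
    have UleV t : U M t <= V t by rewrite /U ge_min lexx.
    exact: (le_Rintegral measurableT (Ui M (P x)) (V_integrable_P x) (fun t _ => UleV t)).
  move: h1 h2 (drift_pop x) K_ge0; move: (T (U M) x) => u h1 h2 h4 h5.
  by rewrite FE /U; case: (leP (V x) M%:R) => h3; lra.
have main M : \int[pi]_x F M x <= K.
  have [mT eT] := kernel_mean mQ sE (mU M) (UM M).
  have TUM x : `|T (U M) x| <= M%:R.
    apply: le_trans (le_normr_Rintegral _ (Ui M _)) _ => //.
    rewrite -[leRHS](mean_cst (P x)); apply: le_Rintegral => //.
      by have := integrable_norm (Ui M (P x)).
    exact: cst_integrable.
  have Ti := bounded_integrable pi mT TUM.
  have Fi := bounded_integrable pi (mF M) (FM M).
  have UFi := integrable_sub (Ui M pi) Fi.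
  have := le_Rintegral measurableT Ti (integrable_add UFi (cst_integrable pi K))
    (fun x _ => TU M x).
  rewrite (RintegralD measurableT UFi (cst_integrable pi K)) mean_cst.
  by rewrite (RintegralB measurableT (Ui M pi) Fi) -eT; lra.
have Fcvg x : (F M x)%:E @[M --> \oo] --> (phi (V x))%:E.
  apply: cvg_near_cst; exists (Num.truncn (V x)).+1 => // M /= hM.
  rewrite FE ifT//; apply: le_trans (ltW (truncnS_gt (V x))) _.
  by rewrite ler_nat.
have mFE M : measurable_fun setT (EFin \o F M) by exact/measurable_EFinP.
rewrite (_ : (\int[pi]_u _)%E = (\int[pi]_u limn (fun M => (F M u)%:E))%E); last first.
  by apply: eq_integral => u _; apply/esym/cvg_lim.
have nd M M' x : (M <= M')%N -> F M x <= F M' x.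
  move=> MM'; rewrite !FE; case: ifP => h; last by case: ifP => // _; exact: phiV_ge0.
  by rewrite ifT// (le_trans h)// ler_nat.
rewrite monotone_convergence//; last 2 first.
- by move=> M x _; rewrite lee_fin.
- by move=> x _ M M' MM'; rewrite lee_fin; exact: nd.
apply: lime_le.
  apply: ereal_nondecreasing_is_cvgn => M M' MM'.
  apply: (@ge0_le_integral _ _ _ pi setT measurableT _ _ _ (mFE M) (mFE M')).
  - by move=> x _; rewrite lee_fin.
  - by move=> x _; rewrite lee_fin; exact: nd.
apply: nearW => M; have Fi := bounded_integrable pi (mF M) (FM M).
by rewrite -(fineK (integrable_fin_num measurableT Fi)) lee_fin; exact: main.
Qed.

End Ergodic.

(** * The ergodic theorem *)

Lemma convex_opp_concave (R : realType) (phi : R -> R) :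
  convex_function (`[0, +oo[%classic : set R^o) (\- phi) ->
  forall t x y : R, 0 <= t -> t <= 1 -> 0 <= x -> 0 <= y ->
    t * phi x + (1 - t) * phi y <= phi (t * x + (1 - t) * y).
Proof.
move=> cvx t x y t0 t1 x0 y0; have := cvx (Itv01 t0 t1) x y.
rewrite !inE/= !in_itv/= !andbT => /(_ x0 y0).
by rewrite !convRE/= /unstable.onem !mulrN -opprD lerN2.
Qed.

(** The contraction argument needs an exponent [al < 1].  For [eps >= 1] the
    denominator [h `^ (1 - eps)] stays bounded on [[b, +oo[], so the rate with
    [al = 1/2] is more than enough. *)
Lemma powR_exponent_below (R : realType) (b eps : R) : 0 < b -> 0 < eps ->
  exists al D, [/\ 0 < al, al < 1, 0 < D &
    forall h, b <= h -> (h `^ (1 - al))^-1 <= D / h `^ (1 - eps)].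
Proof.
move=> b0 eps0; have [eps1|eps1] := ltP eps 1.
  by exists eps, 1; split => // h _; rewrite mul1r.
exists (2^-1), (b `^ (2^-1 - eps)); split; [lra|lra|exact: powR_gt0|move=> h bh].
have h0 : 0 < h by exact: lt_le_trans bh.
rewrite -!powRN.
have -> : - (1 - 2^-1) = (2^-1 - eps) - (1 - eps) :> R by lra.
rewrite powRD; last by rewrite (gt_eqF h0) implybT.
apply: ler_wpM2r; first exact: powR_ge0.
rewrite -(opprB eps) !powRN lef_pV2 ?posrE ?powR_gt0//.
by apply: ge0_ler_powR; rewrite ?nnegrE ?(ltW b0) ?(ltW h0)//; lra.
Qed.

Theorem theorem2p1 (R : realType) (E : completeMetricType R)
    (dO : measure_display) (Omega : measurableType dO)
    (PP : borel E -> probability Omega R)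
    (X : nat -> {mfun Omega >-> borel E})
    (V : borel E -> R) (phi : R -> R) (K R0 rho : R)
    (hX : homogeneous_markov_chain PP X)
    (hVmeas : measurable_fun [set: borel E] V)
    (hV0 : forall x, 0 <= V x)
    (hphi_ge0 : forall t : R, 0 <= t -> 0 <= phi t)
    (hphi_concave : convex_function (`[0, +oo[%classic : set R^o) (\- phi))
    (hphi_diff : derivable_oy_Rcontinuous phi 0)
    (hphi_incr : {in `[0, +oo[ &, {homo phi : s t / s < t}})
    (hphi_infty : phi t @[t --> +oo] --> +oo)
    (hphi0 : phi 0 = 0)
    (hK : 0 <= K)
    (hdrift : forall x, (markov_fun (transition PP X 1) (EFin \o V) x <=
                         (V x - phi (V x) + K)%:E)%E)
    (hsep : separable E)
    (hcontr : forall x y : E,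
       (wasserstein (transition PP X 1 x) (transition PP X 1 y)
          <= (mdist x y)%:E)%E /\ mdist x y <= 1)
    (hR0 : phi_inv phi (2 * K) < R0)
    (hrho : 0 < rho)
    (hsmall : forall x y : E, V x + V y <= R0 ->
       (wasserstein (transition PP X 1 x) (transition PP X 1 y)
          <= ((1 - rho) * mdist x y)%:E)%E) :
  exists pi : probability (borel E) R,
    [/\ stationary (transition PP X 1) pi,
        forall pi' : probability (borel E) R,
          stationary (transition PP X 1) pi' ->
          forall A, measurable A -> pi' A = pi A,
        (\int[pi]_u (phi (V u))%:E <= K%:E)%E
      & forall eps : R, 0 < eps ->
        exists C1 C2 : R, [/\ 0 < C1, 0 < C2 &
          forall (x : E) (n : nat),
            (wasserstein (transition PP X n x) pi <=
             (C1 * (1 + V x) /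
              (phi (H_phi_inv phi (C2 * n%:R))) `^ (1 - eps))%:E)%E]].
Proof.
have dist_le1 x y : mdist x y <= 1 := (hcontr x y).2.
have W_le x y := (hcontr x y).1.
have conc := convex_opp_concave hphi_concave.
have incr (x y : R) : 0 <= x -> x < y -> phi x < phi y.
  move=> x0 xy; apply: hphi_incr => //; rewrite in_itv/= andbT//.
  exact: le_trans (ltW xy).
have cont := derivable_oy_Rcontinuous_within_itvcy hphi_diff.
have [R0_gt0 R0_large] : 0 < R0 /\ 2 * K < phi R0.
  by apply: phi_inv_lt hR0 => //; rewrite mulr_ge0.
(* The contraction constant must be positive for its powers to be used. *)
have [rho' [rho'0 rho'1 small]] : exists rho' : R, [/\ 0 < rho', rho' < 1 &
    forall x y : E, V x + V y <= R0 ->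
    (wasserstein (transition PP X 1 x) (transition PP X 1 y)
      <= ((1 - rho') * mdist x y)%:E)%E].
  exists (Num.min rho 2^-1); split.
    by rewrite lt_min hrho invr_gt0 ltr0n.
    by rewrite gt_min (_ : 2^-1 < 1 :> R) ?orbT//; lra.
  move=> x y /hsmall/le_trans; apply; rewrite lee_fin ler_wpM2r ?mdist_ge0//.
  by rewrite lerD2l lerN2 ge_min lexx.
have mQ := transition_measurable hX.
have Q0 := transition0 hX.
have QS := transitionS hX.
have [pi [lim rate]] := ergodic_measure hsep dist_le1 mQ Q0 QS hVmeas hV0
  conc incr hphi0 cont hK hdrift W_le R0_gt0 R0_large rho'0 rho'1 small hphi_infty.
have spi : stationary (transition PP X 1) pi.
  exact: (limit_stationary hsep dist_le1 mQ hVmeas hV0 hdrift W_le lim).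
exists pi; split => //.
- move=> pi' spi' A mA.
  exact: (stationary_unique hsep dist_le1 mQ Q0 QS hVmeas hV0 hdrift W_le lim spi' mA).
- exact: (stationary_moment mQ hVmeas hV0 incr hphi0 cont hK hdrift spi).
move=> eps eps0; have p1 : 0 < phi 1 by rewrite -hphi0; exact: incr.
have [al [D [al0 al1 D0 hD]]] := powR_exponent_below p1 eps0.
have [k [C [k0 C0 hC]]] := rate al al0 al1.
(* [C2] is a lower bound for the increase of [H_phi] over an Euler step. *)
exists (C * D), (k / (1 + k * phi 1)); split.
- by rewrite mulr_gt0.
- by rewrite divr_gt0// addr_gt0// mulr_gt0.
move=> x n; apply: (kantorovich_rubinstein hsep dist_le1) => f lf.
rewrite (Q_pop hsep dist_le1 mQ Q0 QS hVmeas hV0 hdrift W_le n x lf).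
apply: le_trans (ler_norm _) _; apply: le_trans (hC f lf n x) _.
have /andP[h1 h2] := rate_H_phi_inv conc incr hphi0 cont n k0.
set h := phi (H_phi_inv _ _) in h1 h2 *.
have h0 : 0 < h := lt_le_trans p1 h1.
rewrite -!mulrA ler_pM2l// mulrCA ler_wpM2l ?addr_ge0//.
apply: le_trans (hD h h1).
rewrite lef_pV2 ?posrE ?powR_gt0//; last exact: lt_le_trans h2.
by apply: ge0_ler_powR; rewrite ?nnegrE ?subr_ge0 ?(ltW al1) ?(ltW h0) ?(le_trans (ltW h0) h2).
Qed.
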